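(* There is an absolute constant $C>0$ such that the following holds. Let $\gamma>0$ and let $M$ be an $m\times n$ Boolean matrix with $\gamma_2(M)\leq \gamma$. Then $M$ contains an all-zeros or all-ones submatrix of size $\delta_1 m\times \delta_2 n$ with $\delta_1,\delta_2\geq 2^{-C\gamma^3}$ (i.e. $\delta_1,\delta_2\ge 2^{-O(\gamma^3)}$).
   Context: A Boolean matrix has all entries in $\{0,1\}$. A submatrix is obtained by selecting any subset of rows and any subset of columns (not necessarily consecutive). For a real matrix $M$, $\gamma_2(M)=\min_{U,V:\,M=UV}\|U\|_{\mathrm{row}}\|V\|_{\mathrm{col}}$, where $\|U\|_{\mathrm{row}}$ is the maximum Euclidean norm of a row of $U$ and $\|V\|_{\mathrm{col}}$ is the maximum Euclidean norm of a column of $V$ (the minimum is over all factorizations with any inner dimension). *)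

(* Defs.v *)
From HB Require Import structures.
From mathcomp Require Import all_boot all_order all_algebra.
From mathcomp Require Import classical_sets reals exp.

Set Implicit Arguments.
Unset Strict Implicit.
Unset Printing Implicit Defensive.

Import Order.TTheory GRing.Theory Num.Theory.

Local Open Scope classical_set_scope.
Local Open Scope ring_scope.

Definition boolean_mx (R : realType) (m n : nat) (M : 'M[R]_(m, n)) : Prop :=
  forall i j, M i j = 0 \/ M i j = 1.

(* The library's norm on matrices is the sup norm, hence this definition. *)
Definition l2norm (R : realType) (k : nat) (v : 'rV[R]_k) : R :=
  Num.sqrt (\sum_(j < k) v ord0 j ^+ 2).

(* The value is 0 when there are no rows. *)
Definition row_norm (R : realType) (m k : nat) (U : 'M[R]_(m, k)) : R :=
  \big[Num.max/0]_(i < m) l2norm (row i U).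

Definition col_norm (R : realType) (k n : nat) (V : 'M[R]_(k, n)) : R :=
  \big[Num.max/0]_(j < n) l2norm (col j V)^T.

Definition gamma2_values (R : realType) (m n : nat) (M : 'M[R]_(m, n)) :
    set R :=
  [set x | exists (k : nat) (U : 'M[R]_(m, k)) (V : 'M[R]_(k, n)),
             M = U *m V /\ x = row_norm U * col_norm V].

(* The minimum is written as an infimum; [inf] is meaningful here because the
   set is nonempty and bounded below, as shown by the next two lemmas. *)
Definition gamma2 (R : realType) (m n : nat) (M : 'M[R]_(m, n)) : R :=
  inf (gamma2_values M).

Lemma gamma2_values_neq0 (R : realType) (m n : nat) (M : 'M[R]_(m, n)) :
  gamma2_values M !=set0.
Proof.
by exists (row_norm M * col_norm (1%:M : 'M_n)), n, M, 1%:M; rewrite mulmx1.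
Qed.

Lemma gamma2_values_ge0 (R : realType) (m n : nat) (M : 'M[R]_(m, n)) :
  lbound (gamma2_values M) 0.
Proof.
move=> _ [k [U [V [_ ->]]]].
by apply: mulr_ge0; [rewrite /row_norm|rewrite /col_norm];
  elim/big_rec: _ => // i x _ x0; rewrite le_max x0 orbT.
Qed.

Definition submatrix (R : realType) (m n : nat) (A : {set 'I_m})
    (B : {set 'I_n}) (M : 'M[R]_(m, n)) : 'M[R]_(#|A|, #|B|) :=
  mxsub (@enum_val _ (mem A)) (@enum_val _ (mem B)) M.

(* Main.v *)
(** Write [M i j = <u_i, v_j>] with [|u_i|^2 <= a] and [|v_j|^2 <= c], and
    assume, complementing [M] if necessary, that at most half of its entries
    are ones.

    Amplification.  By Grothendieck's inequality there are signs with
    [sum W_ij s_i t_j >= sum W_ij M_ij / (98 a)] for any weights [W]; passing to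
    one of the rectangles [{s = 1} x {t = -1}], [{s = -1} x {t = 1}] multiplies
    the density of ones by about [1 - 1/(98 a)] at the cost of a constant factor
    in the size.  After O(gamma^3) rounds the density is below
    [2^(- O(gamma^2))].

    Sparse matrices.  Take disjoint clusters of rows, each inside the support of
    one column [j], and subtract from every [u_i] the (near) centre of the
    smallest ball around its cluster.  This centre is a convex combination of
    rows of the cluster, and since the cluster lies in the hyperplane
    [<., v_j> = 1], [|u_i|^2] drops by about [1/c].  The error made in [M] is
    the matrix of weighted densities of columns on clusters.  It is nonnegative
    and, if the relative sizes of the clusters are at least comparable to those
    of the row supports, a subfamily of clusters covering a 1/poly(gamma)
    fraction of the rows has small column sums on most columns, so that the
    error has a factorization of small norm.  This gives a rectangle on which
    [M] is again exactly factored, with a smaller [a + c].  The comparison of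
    sizes is ensured by taking the largest scale at which row clusters or
    column clusters (whichever are larger) cover a quarter of the matrix; the
    density grows by a constant factor only.  As [a + c >= 0], one of the first
    O(gamma^2) rounds must fail to find clusters, and then most rows vanish on
    most columns. *)
Require Import Defs.
From HB Require Import structures.
From mathcomp Require Import all_boot all_order all_algebra.
From mathcomp Require Import classical_sets reals exp.
From mathcomp Require Import boolp fintype finset ring lra.

Set Implicit Arguments.
Unset Strict Implicit.
Unset Printing Implicit Defensive.

Import Order.TTheory GRing.Theory Num.Theory.
Local Open Scope ring_scope.

(** * Rademacher sums and Grothendieck's inequality *)

(** Each new independent sign doubles the sample space, which stays finite so that expectations are
    plain sums. With [f] the old sum and [t] its second moment, E(f ± a)^4 = a^4 + 6 a^2 t + E f^4,
    and this is at most 3 (a^2 + t)^2 once E f^4 <= 3 t^2. *)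
Lemma rademacher_ord (R : realType) (n : nat) :
  exists (O : finType) (s : 'I_n -> O -> R),
    [/\ (0 < #|O|)%N,
        forall u v : 'I_n -> R,
          \sum_w (\sum_k u k * s k w) * (\sum_k v k * s k w) =
            #|O|%:R * \sum_k u k * v k
      & forall u : 'I_n -> R,
          \sum_w (\sum_k u k * s k w) ^+ 4 <=
            3 * #|O|%:R * (\sum_k u k ^+ 2) ^+ 2].
Proof.
elim: n => [|n [O [s [O_gt0 cov4 mom4]]]].
  exists unit, (fun _ _ => 0); rewrite card_unit; split=> // [u v|u].
    by rewrite big1 => [|w _]; rewrite !big_ord0 ?mulr0.
  by rewrite big1 => [|w _]; rewrite !big_ord0 expr0n //= mulr0.
pose s' (k : 'I_n.+1) (p : O * bool) : R :=
  if unlift ord0 k is Some j then s j p.1 else (-1) ^+ p.2.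
have s'E (u : 'I_n.+1 -> R) w b : \sum_k u k * s' k (w, b) =
    u ord0 * (-1) ^+ b + \sum_k u (lift ord0 k) * s k w.
  rewrite big_ord_recl {1}/s' unlift_none; congr (_ + _).
  by apply: eq_bigr => k _; rewrite /s' liftK.
have sumE (F : O * bool -> R) :
    \sum_p F p = \sum_w (F (w, true) + F (w, false)).
  rewrite -(eq_bigr _ (fun p _ => congr1 F (esym (surjective_pairing p)))).
  rewrite -(pair_bigA _ (fun w b => F (w, b))) /=.
  by apply: eq_bigr => w _; rewrite big_bool.
have card' : #|{: O * bool}|%:R = 2 * #|O|%:R :> R.
  by rewrite card_prod card_bool natrM mulrC.
exists (O * bool)%type, s'; split=> [|u v|u].
- by rewrite card_prod card_bool muln_gt0 O_gt0.
- rewrite sumE card' big_ord_recl mulrDr -(mulrA 2 _ (\sum_i _)) -cov4.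
  rewrite -sum1_card natr_sum -[X in X + _]mulrA mulr_suml !mulr_sumr.
  rewrite -big_split /=.
  by apply: eq_bigr => w _; rewrite !s'E /=; ring.
- rewrite sumE card' big_ord_recl.
  set a := u ord0; set f := fun w => \sum_k u (lift ord0 k) * s k w.
  set t := \sum_k u (lift ord0 k) ^+ 2.
  have -> : \sum_w ((\sum_k u k * s' k (w, true)) ^+ 4 +
      (\sum_k u k * s' k (w, false)) ^+ 4) =
      2 * (\sum_w f w ^+ 4) + 12 * a ^+ 2 * (\sum_w f w * f w)
      + 2 * a ^+ 4 * #|O|%:R.
    rewrite -sum1_card natr_sum !mulr_sumr -!big_split /=.
    by apply: eq_bigr => w _; rewrite !s'E /= -/(f w) -/a; ring.
  have -> : \sum_w f w * f w = #|O|%:R * t.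
    by rewrite cov4 /t; congr (_ * _); apply: eq_bigr => k _; rewrite expr2.
  have := mom4 (fun k => u (lift ord0 k)); rewrite -/t -/f => le4.
  have N0 : 0 <= #|O|%:R * a ^+ 4 :> R by rewrite mulr_ge0 // exprn_even_ge0.
  have -> : 3 * (2 * #|O|%:R) * (a ^+ 2 + t) ^+ 2 =
    2 * (3 * #|O|%:R * t ^+ 2) + 12 * a ^+ 2 * (#|O|%:R * t)
    + 2 * a ^+ 4 * #|O|%:R + 4 * (#|O|%:R * a ^+ 4) by ring.
  by rewrite -/(f) in le4 *; lra.
Qed.

Lemma rademacher (R : realType) (K : finType) :
  exists (O : finType) (s : K -> O -> R),
    [/\ (0 < #|O|)%N,
        forall u v : K -> R,
          \sum_w (\sum_k u k * s k w) * (\sum_k v k * s k w) =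
            #|O|%:R * \sum_k u k * v k
      & forall u : K -> R,
          \sum_w (\sum_k u k * s k w) ^+ 4 <=
            3 * #|O|%:R * (\sum_k u k ^+ 2) ^+ 2].
Proof.
have [O [s [O_gt0 cov4 mom4]]] := rademacher_ord R #|K|.
have sumE (F : K -> R) : \sum_k F k = \sum_(i < #|K|) F (enum_val i).
  by rewrite (reindex (@enum_val K K)) //; apply: onW_bij; exact: enum_val_bij.
pose s' k w := s (enum_rank k) w.
have s'E (u : K -> R) w :
    \sum_k u k * s' k w = \sum_i u (enum_val i) * s i w.
  by rewrite sumE; apply: eq_bigr => i _; rewrite /s' enum_valK.
exists O, s'; split=> // [u v|u].
  rewrite [in RHS]sumE -cov4.
  by apply: eq_bigr => w _; rewrite !s'E.
rewrite (sumE (fun k => u k ^+ 2)).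
apply: le_trans (mom4 (fun i => u (enum_val i))).
by under eq_bigr do rewrite s'E.
Qed.

Lemma linear_le_signs (R : realType) (I : finType) (L x : I -> R) (T : R) :
  (forall i, `|x i| <= T) ->
  exists s : I -> bool, \sum_i x i * L i <= T * \sum_i (-1) ^+ s i * L i.
Proof.
move=> xT; exists (fun i => L i < 0).
rewrite mulr_sumr; apply: ler_sum => i _.
rewrite -normrEsign; apply: le_trans (ler_norm _) _.
by rewrite normrM ler_wpM2r.
Qed.

(** A bilinear form on a cube is largest at a vertex: first the [x i] are replaced by signs, then,
    with these fixed, the [y j]; each replacement costs a factor [T]. *)
Lemma bilinear_le_signs (R : realType) (I J : finType) (W : I -> J -> R)
    (S T : R) (x : I -> R) (y : J -> R) :
  0 <= T ->
  (forall (s : I -> bool) (t : J -> bool),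
     \sum_i \sum_j W i j * ((-1) ^+ s i * (-1) ^+ t j) <= S) ->
  (forall i, `|x i| <= T) -> (forall j, `|y j| <= T) ->
  \sum_i \sum_j W i j * (x i * y j) <= T ^+ 2 * S.
Proof.
move=> T0 WS xT yT.
have [s les] := linear_le_signs (fun i => \sum_j W i j * y j) xT.
have [t let_] := linear_le_signs (fun j => \sum_i (-1) ^+ s i * W i j) yT.
apply: (@le_trans _ _ (T * (T * \sum_j (-1) ^+ t j *
    \sum_i (-1) ^+ s i * W i j))); last first.
  rewrite mulrA -expr2 ler_wpM2l ?exprn_ge0 //; apply: le_trans (WS s t).
  rewrite exchange_big /= le_eqVlt; apply/orP; left; apply/eqP.
  apply: eq_bigr => j _; rewrite mulr_sumr; apply: eq_bigr => i _; ring.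
apply: le_trans (ler_wpM2l T0 let_).
apply: le_trans (le_trans les _).
  rewrite le_eqVlt; apply/orP; left; apply/eqP.
  apply: eq_bigr => i _; rewrite mulr_sumr; apply: eq_bigr => j _; ring.
rewrite ler_wpM2l // le_eqVlt; apply/orP; left; apply/eqP.
rewrite (eq_bigr _ (fun i _ => mulr_sumr _ _ _ _)) exchange_big /=.
apply: eq_bigr => j _; rewrite mulr_sumr; apply: eq_bigr => i _; ring.
Qed.

Definition clamp (R : realType) (T x : R) : R :=
  if x < - T then - T else if T < x then T else x.

Lemma clamp_norm (R : realType) (T x : R) : 0 <= T -> `|clamp T x| <= T.
Proof.
by move=> T0; rewrite /clamp ler_norml; case: ltP => h1; [|case: ltP => h2];
  apply/andP; split; lra.
Qed.

Lemma clamp_sqr (R : realType) (T x : R) : 0 <= T -> clamp T x ^+ 2 <= x ^+ 2.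
Proof.
by move=> T0; rewrite /clamp; case: ltP => h1; [|case: ltP => h2]; nra.
Qed.

(** The remainder vanishes unless [|x|] exceeds [T]; then its square is at most [x ^+ 2], and
    [x ^+ 2 / T ^+ 2] is at least 1. *)
Lemma clamp_rest (R : realType) (T x : R) :
  0 < T -> (x - clamp T x) ^+ 2 <= x ^+ 4 / T ^+ 2.
Proof.
move=> T0; rewrite ler_pdivlMr ?exprn_gt0 //.
have -> : x ^+ 4 = x ^+ 2 * x ^+ 2 by ring.
rewrite /clamp; case: ltP => h1; [|case: ltP => h2].
- by apply: ler_pM; rewrite ?sqr_ge0 //; nra.
- by apply: ler_pM; rewrite ?sqr_ge0 //; nra.
- by rewrite subrr expr0n mul0r mulr_ge0 ?sqr_ge0.
Qed.

Lemma dot_norm_le1 (R : realType) (K : finType) (u v : K -> R) :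
  \sum_k u k ^+ 2 <= 1 -> \sum_k v k ^+ 2 <= 1 -> `|\sum_k u k * v k| <= 1.
Proof.
move=> u1 v1.
have : 0 <= \sum_k (u k + v k) ^+ 2 by apply: sumr_ge0 => k _; exact: sqr_ge0.
have : 0 <= \sum_k (u k - v k) ^+ 2 by apply: sumr_ge0 => k _; exact: sqr_ge0.
have -> : \sum_k (u k - v k) ^+ 2 =
  \sum_k u k ^+ 2 + \sum_k v k ^+ 2 - 2 * \sum_k u k * v k.
  by rewrite mulr_sumr -sumrN -!big_split /=; apply: eq_bigr => k _; ring.
have -> : \sum_k (u k + v k) ^+ 2 =
  \sum_k u k ^+ 2 + \sum_k v k ^+ 2 + 2 * \sum_k u k * v k.
  by rewrite mulr_sumr -!big_split /=; apply: eq_bigr => k _; ring.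
by rewrite ler_norml => ? ?; apply/andP; split; lra.
Qed.

(* With [X_i], [Y_j] Rademacher sums of covariance [<u_i, v_j>], the truncations
   at 7 contribute at most [49 * S], and by the fourth moment bound the
     remainders
   have norm at most [1/4] in L2, so the supremum [E] of the left-hand side over
   all families of vectors satisfies [E <= 49 * S + 2 * (E / 4)]. *)
Lemma grothendieck (R : realType) (I J : finType) (W : I -> J -> R) (S : R) :
  (forall (s : I -> bool) (t : J -> bool),
     \sum_i \sum_j W i j * ((-1) ^+ s i * (-1) ^+ t j) <= S) ->
  forall (K : finType) (u : I -> K -> R) (v : J -> K -> R),
    (forall i, \sum_k u i k ^+ 2 <= 1) -> (forall j, \sum_k v j k ^+ 2 <= 1) ->
    \sum_i \sum_j W i j * (\sum_k u i k * v j k) <= 98 * S.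
Proof.
move=> WS.
(* The dimension is left free in [E], so that random variables on the sample space [O] below count
   as vectors. *)
pose E : set R := [set x | exists (K : finType) (u : I -> K -> R)
  (v : J -> K -> R), [/\ forall i, \sum_k u i k ^+ 2 <= 1,
    forall j, \sum_k v j k ^+ 2 <= 1 &
    x = \sum_i \sum_j W i j * (\sum_k u i k * v j k)]]%classic.
have supE : has_sup E.
  split.
    exists 0, unit, (fun _ _ => 0), (fun _ _ => 0).
    split=> [i|j|]; try by rewrite big1 // => *; rewrite expr0n.
    by rewrite big1 // => i _; rewrite big1 // => j _;
      rewrite big1 ?mulr0 // => *;
      rewrite mulr0.
  exists (\sum_i \sum_j `|W i j|) => _ [K [u [v [u1 v1 ->]]]].
  apply: ler_sum => i _; apply: ler_sum => j _.
  apply: le_trans (ler_norm _) _; rewrite normrM ler_piMr //.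
  exact: dot_norm_le1.
have leK (K : finType) (u : I -> K -> R) (v : J -> K ->
  R) : (forall i, \sum_k u i k ^+ 2 <= 1) ->
    (forall j, \sum_k v j k ^+ 2 <= 1) ->
    \sum_i \sum_j W i j * (\sum_k u i k * v j k) <= sup E.
  by move=> u1 v1; apply: sup_upper_bound => //; exists K, u, v.
suff le_half : sup E <= 49 * S + sup E / 2.
  by move=> K u v u1 v1; apply: le_trans (leK K u v u1 v1) _; lra.
apply: ge_sup; first by case: supE.
move=> _ [K [u [v [u1 v1 ->]]]].
have [O [s [O_gt0 cov4 mom4]]] := rademacher R K.
set N : R := #|O|%:R.
have N0 : 0 < N by rewrite ltr0n.
have r0 : 0 < Num.sqrt N by rewrite sqrtr_gt0.
have r2 : Num.sqrt N ^+ 2 = N by rewrite sqr_sqrtr // ltW.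
pose X i w := \sum_k u i k * s k w; pose Y j w := \sum_k v j k * s k w.
have mom2 (z : K -> R) : \sum_k z k ^+ 2 <= 1 ->
    \sum_w (\sum_k z k * s k w) ^+ 2 <= N.
  move=> z1; rewrite (eq_bigr _ (fun w _ => expr2 _)) cov4.
  by rewrite -(eq_bigr _ (fun k _ => expr2 _)) ler_piMr // ltW.
(* The truncation level 7 is large enough because [3 / 7 ^+ 2 <= 1 / 16]. *)
have momr (z : K -> R) : \sum_k z k ^+ 2 <= 1 ->
    \sum_w (\sum_k z k * s k w - clamp 7 (\sum_k z k * s k w)) ^+ 2 <= N / 16.
  move=> z1.
  apply: (@le_trans _ _ (\sum_w (\sum_k z k * s k w) ^+ 4 / 7 ^+ 2)).
    by apply: ler_sum => w _; apply: clamp_rest.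
  rewrite -mulr_suml; have := mom4 z; rewrite -/N.
  have : 0 <= \sum_k z k ^+ 2 by apply: sumr_ge0 => k _; exact: sqr_ge0.
  move=> z0 h4; have zz : (\sum_k z k ^+ 2) ^+ 2 <= 1 by rewrite exprn_ile1.
  have : 3 * N * (\sum_k z k ^+ 2) ^+ 2 <= 3 * N by rewrite ler_piMr //; lra.
  by lra.
have scale (f : O -> R) (c : R) : \sum_w f w ^+ 2 <= N / c ^+ 2 -> 0 < c ->
    \sum_w (c / Num.sqrt N * f w) ^+ 2 <= 1.
  move=> le_f c0; under eq_bigr do rewrite exprMn expr_div_n r2.
  rewrite -mulr_sumr mulrAC ler_pdivrMr // mul1r.
  by rewrite mulrC -ler_pdivlMr ?exprn_gt0.
(* Scaled by [c / sqrt N] and [d / sqrt N], the families [f] and [g] become admissible vectors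
   indexed by [O]. *)
have part (f : I -> O -> R) (g : J -> O -> R) (c d : R) : 0 < c -> 0 < d ->
    (forall i, \sum_w f i w ^+ 2 <= N / c ^+ 2) ->
    (forall j, \sum_w g j w ^+ 2 <= N / d ^+ 2) ->
    \sum_w \sum_i \sum_j W i j * (f i w * g j w) <= N * (sup E / (c * d)).
  move=> c0 d0 lef leg.
  have := leK O (fun i w => c / Num.sqrt N * f i w)
    (fun j w => d / Num.sqrt N * g j w)
    (fun i => scale _ _ (lef i) c0) (fun j => scale _ _ (leg j) d0).
  have -> : \sum_i \sum_j W i j * (\sum_w c / Num.sqrt N * f i w *
      (d / Num.sqrt N * g j w)) =
      c * d / N * \sum_w \sum_i \sum_j W i j * (f i w * g j w).
    rewrite [in RHS]exchange_big mulr_sumr; apply: eq_bigr => i _ /=.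
    rewrite [in RHS]exchange_big mulr_sumr; apply: eq_bigr => j _ /=.
    rewrite !mulr_sumr; apply: eq_bigr => w _.
    by rewrite -[in RHS]r2; field; rewrite gt_eqF.
  have cd0 : 0 < c * d by rewrite mulr_gt0.
  move=> le_sup; rewrite -(ler_pM2l (divr_gt0 cd0 N0)).
  apply: le_trans le_sup _.
  rewrite le_eqVlt; apply/orP; left; apply/eqP.
  by field; rewrite !gt_eqF.
pose c1 i w := clamp 7 (X i w); pose c2 j w := clamp 7 (Y j w).
(* This asymmetric splitting has only two error terms, each pairing a remainder of L2 norm at most
   1/4 with a variable of norm at most 1. *)
have mainE : N * (\sum_i \sum_j W i j * (\sum_k u i k * v j k)) =
    \sum_w \sum_i \sum_j W i j * (c1 i w * c2 j w)
    + \sum_w \sum_i \sum_j W i j * ((X i w - c1 i w) * c2 j w)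
    + \sum_w \sum_i \sum_j W i j * (X i w * (Y j w - c2 j w)).
  rewrite -!big_split /=.
  transitivity (\sum_w \sum_i \sum_j W i j * (X i w * Y j w)).
    rewrite mulr_sumr exchange_big; apply: eq_bigr => i _ /=.
    rewrite mulr_sumr exchange_big; apply: eq_bigr => j _ /=.
    by rewrite -mulr_sumr /X /Y cov4 -/N; ring.
  apply: eq_bigr => w _; rewrite -!big_split /=; apply: eq_bigr => i _.
  by rewrite -!big_split /=; apply: eq_bigr => j _; ring.
have t1 : \sum_w \sum_i \sum_j W i j * (c1 i w * c2 j w) <= N * (49 * S).
  rewrite /N -sum1_card natr_sum mulr_suml; apply: ler_sum => w _.
  rewrite mul1r (_ : 49 = 7 ^+ 2); last by ring.
  by apply: bilinear_le_signs => // *; exact: clamp_norm.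
have t2 : \sum_w \sum_i \sum_j W i j * ((X i w - c1 i w) * c2 j w) <=
    N * (sup E / (4 * 1)).
  apply: part => // [i|j].
    by rewrite (_ : 4 ^+ 2 = 16); [exact: momr | ring].
  rewrite expr1n divr1; apply: le_trans (mom2 _ (v1 j)).
  by apply: ler_sum => w _; exact: clamp_sqr.
have t3 : \sum_w \sum_i \sum_j W i j * (X i w * (Y j w - c2 j w)) <=
    N * (sup E / (1 * 4)).
  apply: part => // [i|j].
    by rewrite expr1n divr1; exact: mom2.
  by rewrite (_ : 4 ^+ 2 = 16); [exact: momr | ring].
rewrite -(ler_pM2l N0) mainE; apply: le_trans (lerD (lerD t1 t2) t3) _.
by rewrite -!mulrDr ler_pM2l //; lra.
Qed.

(** * Factorizations and density amplification *)

(** The bounds are on squared norms, and are kept apart because recentring lowers one while raising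
    the other. *)
Definition factored (R : realType) (I J : finType) (M : I -> J -> bool)
    (A : {set I}) (B : {set J}) (a c : R) : Prop :=
  exists (K : finType) (u : I -> K -> R) (v : J -> K -> R),
    [/\ forall i, i \in A -> \sum_k u i k ^+ 2 <= a,
        forall j, j \in B -> \sum_k v j k ^+ 2 <= c
      & forall i j, i \in A -> j \in B -> \sum_k u i k * v j k = (M i j)%:R].

Definition edges (R : realType) (I J : finType) (M : I -> J -> bool)
    (A : {set I}) (B : {set J}) : R :=
  \sum_(i in A) \sum_(j in B) (M i j)%:R.

(** Put [d = (98 * a)^-1]. The weights [L * M - 1] on [A] times [B] sum against [M] to
    [(L - 1) * edges], so Grothendieck gives signs whose weighted sum is at least
    [d * (L - 1) * edges]. The two rectangles of opposite signs together carry half of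
    [#|A| * #|B| - L * edges] plus half of that sum; the better one has at least half of the
    total. *)
Lemma amplify_step (R : realType) (I J : finType) (M : I -> J -> bool)
    (A : {set I}) (B : {set J}) (a L : R) :
  0 < a -> factored M [set: I] [set: J] a a ->
  exists (A' : {set I}) (B' : {set J}),
    (#|A|%:R * #|B|%:R - (L * (1 - (98 * a)^-1) + (98 * a)^-1)
       * edges R M A B) / 4 <= #|A'|%:R * #|B'|%:R - L * edges R M A' B'.
Proof.
move=> a0 [K [u [v [ua va uvM]]]].
pose ind (T : finType) (D : {set T}) (x : T) : R := (x \in D)%:R.
have phiE (D : {set I}) (E : {set J}) (c : R) :
    #|D|%:R * #|E|%:R - c * edges R M D E =
    \sum_i \sum_j ind I D i * ind J E j * (1 - c * (M i j)%:R).
  have cardE (T : finType) (X : {set T}) : #|X|%:R = \sum_x ind T X x.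
    rewrite -sum1_card natr_sum big_mkcond; apply: eq_bigr => x _.
    by rewrite /ind; case: (x \in X).
  rewrite /edges !cardE mulr_suml mulr_sumr [X in _ - X]big_mkcond -sumrB.
  apply: eq_bigr => i _; rewrite {2}/ind mulr_sumr /=.
  case: (boolP (i \in D)) => iD; last first.
    by rewrite subr0; apply: eq_bigr => j _; rewrite /ind (negPf iD) !mul0r.
  rewrite mulr_sumr [X in _ - X]big_mkcond -sumrB; apply: eq_bigr => j _.
  by rewrite /ind iD; case: (j \in E) => /=; ring.
pose W i j := ind I A i * ind J B j * (L * (M i j)%:R - 1).
pose f (p : {ffun I -> bool} * {ffun J -> bool}) :=
  \sum_i \sum_j W i j * ((-1) ^+ p.1 i * (-1) ^+ p.2 j).
have [p pmax] : exists p, forall p', f p' <= f p.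
  have p0 : {ffun I -> bool} * {ffun J ->
    bool} := ([ffun _ => true], [ffun _ => true]).
  by case: (arg_maxP f (i0 := p0) (P := predT) isT) => p _ h; exists p => p';
    exact: h.
have r0 : 0 < Num.sqrt a by rewrite sqrtr_gt0.
have r2 : Num.sqrt a ^+ 2 = a by rewrite sqr_sqrtr // ltW.
have unit_le (T : finType) (z : T -> R) : \sum_k z k ^+ 2 <= a ->
    \sum_k (z k / Num.sqrt a) ^+ 2 <= 1.
  move=> za; under eq_bigr do rewrite expr_div_n r2.
  by rewrite -mulr_suml ler_pdivrMr // mul1r.
have f_max (s : I -> bool) (t : J -> bool) :
    \sum_i \sum_j W i j * ((-1) ^+ s i * (-1) ^+ t j) <= f p.
  apply: le_trans (pmax ([ffun i => s i], [ffun j => t j])).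
  rewrite /f /= le_eqVlt; apply/orP; left; apply/eqP.
  by apply: eq_bigr => i _; apply: eq_bigr => j _; rewrite !ffunE.
have := @grothendieck R I J W (f p) f_max K (fun i k => u i k / Num.sqrt a)
  (fun j k => v j k / Num.sqrt a) (fun i => unit_le _ _ (ua i (in_setT i)))
  (fun j => unit_le _ _ (va j (in_setT j))).
have -> : \sum_i \sum_j W i j *
    (\sum_k u i k / Num.sqrt a * (v j k / Num.sqrt a)) =
    (\sum_i \sum_j W i j * (M i j)%:R) / a.
  rewrite mulr_suml; apply: eq_bigr => i _; rewrite mulr_suml.
  apply: eq_bigr => j _; rewrite -uvM ?in_setT // -mulrA mulr_suml.
  congr (_ * _); apply: eq_bigr => k _.
  by rewrite -[in RHS]r2; field; rewrite gt_eqF.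
move=> WM.
pose A1 := [set i in A | p.1 i]; pose A2 := [set i in A | ~~ p.1 i].
pose B1 := [set j in B | ~~ p.2 j]; pose B2 := [set j in B | p.2 j].
have sumE : (#|A1|%:R * #|B1|%:R - L * edges R M A1 B1)
    + (#|A2|%:R * #|B2|%:R - L * edges R M A2 B2) =
    (#|A|%:R * #|B|%:R - L * edges R M A B + f p) / 2.
  rewrite !phiE /f -!big_split /= mulr_suml; apply: eq_bigr => i _.
  rewrite -!big_split /= mulr_suml; apply: eq_bigr => j _.
  rewrite /W /ind !inE; case: (i \in A); case: (j \in B); case: (p.1 i);
    case: (p.2 j); rewrite /= ?expr0 ?expr1; by field.
have f_ge : (98 * a)^-1 * (\sum_i \sum_j W i j * (M i j)%:R) <= f p.
  move: WM; rewrite ler_pdivrMr // => WM.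
  rewrite mulrC ler_pdivrMr ?mulr_gt0 //; apply: le_trans WM _.
  by rewrite le_eqVlt; apply/orP; left; apply/eqP; ring.
have WME : \sum_i \sum_j W i j * (M i j)%:R = (L - 1) * edges R M A B.
  rewrite /edges mulr_sumr [RHS]big_mkcond; apply: eq_bigr => i _.
  rewrite /W /ind; case: (i \in A); last by rewrite big1 // => j _;
    rewrite !mul0r.
  rewrite mulr_sumr [RHS]big_mkcond; apply: eq_bigr => j _.
  by case: (j \in B); case: (M i j) => /=; ring.
rewrite WME in f_ge; set d := (98 * a)^-1 in f_ge *.
have [le1|lt1] := lerP ((#|A|%:R * #|B|%:R - (L * (1 - d) + d)
          * edges R M A B) / 4) (#|A1|%:R * #|B1|%:R - L * edges R M A1 B1).
  by exists A1, B1.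
by exists A2, B2; move: sumE f_ge lt1; lra.
Qed.

(** With [d = (98 * a)^-1], one has [L * (1 - d) + d = 1 + (L - 1) * (1 - d)] and
    [(1 + d) * (1 - d) <= 1], so [L - 1] may grow by the factor [1 + d] in each round. *)
Lemma amplify (R : realType) (I J : finType) (M : I -> J -> bool)
    (A : {set I}) (B : {set J}) (a x : R) (n : nat) :
  0 < a -> 0 <= x -> factored M [set: I] [set: J] a a ->
  exists (A' : {set I}) (B' : {set J}),
    (#|A|%:R * #|B|%:R - (1 + x) * edges R M A B) / 4 ^+ n <=
      #|A'|%:R * #|B'|%:R - (1 + x * (1 + (98 * a)^-1) ^+ n) * edges R M A' B'.
Proof.
move=> a0 x0 fM; elim: n => [|n [A1 [B1 IH]]].
  by exists A, B; rewrite !expr0 mulr1 divr1.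
set d := (98 * a)^-1 in IH *.
have d0 : 0 < d by rewrite invr_gt0 mulr_gt0.
have [A2 [B2 step]] := amplify_step A1 B1 (1 + x * (1 + d) ^+ n.+1) a0 fM.
exists A2, B2; rewrite -/d in step; apply: le_trans step.
rewrite exprSr invfM mulrA ler_pM2r ?invr_gt0 //; apply: le_trans IH _.
rewrite lerD2l lerN2 ler_wpM2r //.
  by apply: sumr_ge0 => i _; apply: sumr_ge0 => j _; exact: ler0n.
have y0 : 0 <= x * (1 + d) ^+ n by rewrite mulr_ge0 // exprn_ge0 //; lra.
rewrite (_ : (1 + x * (1 + d) ^+ n.+1) * (1 - d) + d =
  1 + x * (1 + d) ^+ n - x * (1 + d) ^+ n * d ^+ 2); last by rewrite exprSr;
    ring.
by rewrite gerBl mulr_ge0 ?sqr_ge0.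
Qed.

(** * Near-centre of the smallest ball around a cluster *)

(* Moving a mass [t] of [mu] onto [j] changes the variance [F] of [u] under [mu]
   by [t * (d - F) - t ^+ 2 * d], where [d] is the squared distance of [u j] to
   the mean; hence the mean of a near-maximizer of [F] is a near-centre of the
   smallest ball enclosing the slice. *)
Lemma slice_center (R : realType) (I K : finType) (C : {set I}) (u : I ->
  K -> R)
    (w : K -> R) (a G : R) :
  1 <= G -> a <= G -> C != set0 ->
  (forall i, i \in C -> \sum_k u i k ^+ 2 <= a) -> \sum_k w k ^+ 2 <= G ->
  (forall i, i \in C -> \sum_k u i k * w k = 1) ->
  exists mu : I -> R,
    [/\ forall i, 0 <= mu i, forall i, i \notin C -> mu i = 0, \sum_i mu i = 1
      & forall i, i \in C ->
          \sum_k (u i k - \sum_l mu l * u l k) ^+ 2 <= a - (2 * G)^-1].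
Proof.
move=> G1 aG /set0Pn[i0 i0C] ua wG uw.
have G0 : 0 < G by lra.
pose dist (mu : I -> R) :=
  [/\ forall i, 0 <= mu i, forall i, i \notin C -> mu i = 0 & \sum_i mu i = 1].
pose x (mu : I -> R) k := \sum_l mu l * u l k.
pose q (mu : I -> R) := \sum_l mu l * \sum_k u l k ^+ 2.
pose F mu := q mu - \sum_k x mu k ^+ 2.
(* The mean lies on the hyperplane [<., w> = 1], so its squared norm is at least [G^-1]; this
   follows from expanding the square of [x mu - w / G]. *)
have F_le mu : dist mu -> F mu <= a - G^-1.
  move=> [mu0 muC mu1].
  have q_le : q mu <= a.
    rewrite -[a]mul1r -mu1 mulr_suml; apply: ler_sum => i _.
    by have [iC|iC] := boolP (i \in C);
      [rewrite ler_wpM2l ?ua | rewrite muC ?mul0r].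
  have xw : \sum_k x mu k * w k = 1.
    rewrite -mu1 /x; under eq_bigr do rewrite mulr_suml.
    rewrite exchange_big; apply: eq_bigr => i _ /=.
    have [iC|iC] := boolP (i \in C).
      by rewrite -[RHS]mulr1 -(uw i iC) mulr_sumr; apply: eq_bigr => k _; ring.
    by rewrite muC // big1 // => k _; rewrite !mul0r.
  have : 0 <= \sum_k (x mu k - w k / G) ^+ 2.
    by apply: sumr_ge0 => k _; exact: sqr_ge0.
  have -> : \sum_k (x mu k - w k / G) ^+ 2 =
      \sum_k x mu k ^+ 2 - 2 / G * (\sum_k x mu k * w k)
      + (\sum_k w k ^+ 2) / G ^+ 2.
    rewrite !(mulr_sumr, mulr_suml) -sumrN -!big_split /=.
    by apply: eq_bigr => k _; field; rewrite gt_eqF.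
  rewrite xw mulr1.
  have : (\sum_k w k ^+ 2) / G ^+ 2 <= G^-1.
    rewrite ler_pdivrMr ?exprn_gt0 //; apply: le_trans wG _.
    by rewrite expr2 mulrA mulVf ?mul1r // gt_eqF.
  by rewrite /F; lra.
pose E : set R := [set F mu | mu in [set mu | dist mu]]%classic.
have supE : has_sup E.
  split; last by exists (a - G^-1) => _ [mu dmu <-]; exact: F_le.
  exists (F (fun i => (i == i0)%:R)); exists (fun i => (i == i0)%:R) => //.
  split=> [i|i iC|]; first exact: ler0n.
    by case: eqP => // ii0; rewrite ii0 i0C in iC.
  by rewrite (bigD1 i0) //= eqxx big1 ?addr0 // => i /negPf->.
(* As [e = t / (4 * G)], near-maximality gives [(1 - t) * d <= F mu + (4 * G)^-1] for a squared
   distance [d] to the mean. Since also [t * a <= (4 * G)^-1], half of the gap [G^-1] of [F_le]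
   survives. *)
set t : R := (4 * G ^+ 2)^-1.
set e : R := (16 * G ^+ 3)^-1.
have e0 : 0 < e by rewrite invr_gt0 mulr_gt0 ?exprn_gt0.
have t0 : 0 < t by rewrite invr_gt0 mulr_gt0 ?exprn_gt0.
have [_ [mu dmu <-] Fmu] := sup_adherent e0 supE.
exists mu; case: (dmu) => mu0 muC mu1; split=> // j jC.
rewrite -[X in X <= _]/(\sum_k (u j k - x mu k) ^+ 2).
set d := \sum_k _.
pose mu' i := (1 - t) * mu i + t * (i == j)%:R.
have t1 : t <= 1 / 4.
  have : t * (4 * G ^+ 2) = 1 by rewrite mulVf // gt_eqF // mulr_gt0 ?exprn_gt0.
  have : t * 1 <= t * G ^+ 2 by rewrite ler_pM2l // exprn_ege1.
  by lra.
have dmu' : dist mu'.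
  split=> [i|i iC|].
  - by rewrite addr_ge0 // mulr_ge0 ?ler0n ?mu0 //; lra.
  - rewrite /mu' muC // mulr0 add0r; case: eqP => [ij|_]; rewrite ?mulr0 //.
    by rewrite ij jC in iC.
  - rewrite big_split -!mulr_sumr /= mu1 (bigD1 j) //= eqxx big1 => [|i
    /negPf-> //].
    by rewrite addr0 !mulr1 subrK.
have sumE (f : I -> R) : \sum_l mu' l * f l = (1 - t) * (\sum_l mu l * f l) + t
  * f j.
  rewrite mulr_sumr -(_ : \sum_l t * (l == j)%:R * f l = t * f j).
    by rewrite -big_split /=; apply: eq_bigr => l _; rewrite /mu'; ring.
  by rewrite (bigD1 j) //= eqxx big1 ?addr0 ?mulr1 // => i /negPf->;
    rewrite mulr0 mul0r.
have FE : F mu' = F mu + t * (d - F mu) - t ^+ 2 * d.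
  rewrite /F /q sumE -/(q mu).
  have -> : \sum_k x mu' k ^+ 2 = \sum_k ((1 - t) * x mu k + t * u j k) ^+ 2.
    by apply: eq_bigr => k _; rewrite /x sumE.
  have -> : \sum_k ((1 - t) * x mu k + t * u j k) ^+ 2 =
      (1 - t) * (\sum_k x mu k ^+ 2) + t * (\sum_k u j k ^+ 2) - t * (1 - t) *
        d.
    rewrite /d !mulr_sumr -sumrN -!big_split /=.
    by apply: eq_bigr => k _; ring.
  ring.
have F'_le : F mu' <= sup E by apply: sup_upper_bound => //; exists mu'.
have Fle := F_le _ dmu.
have teE : e = t * (4 * G)^-1 by rewrite /e /t; field; rewrite gt_eqF.
have hd : t * (d * (1 - t)) <= t * (F mu + (4 * G)^-1).
  by move: Fmu F'_le; rewrite FE (mulrDr t (F mu)) -teE; lra.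
rewrite ler_pM2l // in hd.
have ta : t * a <= (4 * G)^-1.
  apply: (@le_trans _ _ (t * G)); first by rewrite ler_wpM2l // ltW.
  by rewrite /t le_eqVlt; apply/orP; left; apply/eqP; field; rewrite gt_eqF.
have i1 : G^-1 = 4 * (4 * G)^-1 by field; rewrite gt_eqF.
have i2 : (2 * G)^-1 = 2 * (4 * G)^-1 by field; rewrite gt_eqF.
have h0 : 0 < (4 * G)^-1 by rewrite invr_gt0 mulr_gt0.
rewrite i1 in Fle; rewrite i2.
have t1' : 0 < 1 - t by lra.
rewrite -(ler_pM2r t1'); nra.
Qed.

(** * Counting, clusters and coverings *)

Lemma sum_card (R : realType) (J : finType) (D : {set J}) (P : pred J) :
  \sum_(j in D) (P j)%:R = #|[set j in D | P j]|%:R :> R.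
Proof.
rewrite -sum1_card natr_sum big_mkcond [RHS]big_mkcond.
by apply: eq_bigr => j _; rewrite inE; case: (j \in D) => //=; case: (P j).
Qed.

Lemma markov_card (R : realType) (J : finType) (D : {set J}) (f : J ->
  R) (c : R) :
  (forall j, j \in D -> 0 <= f j) ->
  c * (#|D|%:R - #|[set j in D | f j <= c]|%:R) <= \sum_(j in D) f j.
Proof.
move=> f0; rewrite -sum_card -sum1_card natr_sum -sumrB mulr_sumr.
apply: ler_sum => j jD; case: (leP (f j) c) => h /=;
  first by rewrite subrr mulr0 f0.
by rewrite subr0 mulr1 ltW.
Qed.

Definition fibre (I J : finType) (tau : I -> option J) (j : J) : {set I} :=
  [set i | tau i == Some j].

(* [tau i] is the column indexing the cluster of the row [i], if any. *)
Definition clustering (R : realType) (I J : finType) (M : I -> J -> bool)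
    (A : {set I}) (B : {set J}) (s : R) (tau : I -> option J) : Prop :=
  (forall i j, tau i = Some j -> [/\ i \in A, j \in B & M i j]) /\
  (forall j, fibre tau j != set0 -> s <= #|fibre tau j|%:R).

(** Cluster sizes are relative to [#|A|], which makes row and column scales comparable. *)
Definition coverable (R : realType) (I J : finType) (M : I -> J -> bool)
    (A : {set I}) (B : {set J}) (kappa : R) : Prop :=
  exists2 tau, clustering M A B (kappa * #|A|%:R) tau
    & #|A|%:R / 4 <= #|[set i | tau i != None]|%:R :> R.

(** Columns are processed in turn: one with at least [s] unassigned rows in its support takes them
    all, any other takes none. Later columns only shrink the set of unassigned rows. *)
Lemma greedy_clustering (R : realType) (I J : finType) (M : I -> J -> bool)
    (A : {set I}) (B : {set J}) (s : R) :
  0 < s ->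
  exists2 tau, clustering M A B s tau
    & forall j, j \in B -> #|[set i in A | M i j && (tau i == None)]|%:R < s.
Proof.
move=> s0.
suff [tau ct tauB] : exists2 tau, clustering M A B s tau & forall j,
    j \in enum B -> #|[set i in A | M i j && (tau i == None)]|%:R < s.
  by exists tau => // j jB; apply: tauB; rewrite mem_enum.
have : all (mem B) (enum B) by apply/allP => j; rewrite mem_enum.
elim: (enum B) => [_|j r IH] /=.
  exists (fun _ => None) => //; split=> // j /set0Pn[i].
  by rewrite inE.
move=> /andP[jB /IH[tau [tauM taus] tauB]].
set D := [set i in A | M i j && (tau i == None)].
have [Ds|sD] := ltP (#|D|%:R : R) s.
  by exists tau => // k; rewrite inE => /orP[/eqP->|/tauB].
exists (fun i => if i \in D then Some j else tau i).
  split=> [i k|k].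
    case: ifP => [iD [<-]|_]; last exact: tauM.
    by move: iD; rewrite inE => /andP[-> /andP[-> _]].
  have [->|kj] := eqVneq k j.
    move=> _; apply: le_trans sD _; rewrite ler_nat subset_leq_card //.
    by apply/subsetP => i iD; rewrite inE iD.
  have -> : fibre (fun i => if i \in D then Some j else tau i) k = fibre tau k.
    apply/setP => i; rewrite !inE; case: ifP => // /andP[_ /andP[_ /eqP->]].
    by apply/eqP => -[jk]; rewrite jk eqxx in kj.
  exact: taus.
move=> k; rewrite inE => /orP[/eqP->|/tauB kr].
  rewrite (_ : finset _ = set0) ?cards0 //.
  apply/setP => i; rewrite !inE.
  by case: (i \in A); case: (M i j); case: (tau i).
apply: le_lt_trans kr; rewrite ler_nat subset_leq_card //.
apply/subsetP => i; rewrite !inE => /andP[-> /andP[->]].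
by case: ifP.
Qed.

(** [Z] consists of the rows assigned by the greedy clustering; were they a quarter of [A], that
    clustering would be a cover. *)
Lemma not_coverable (R : realType) (I J : finType) (M : I -> J -> bool)
    (A : {set I}) (B : {set J}) (kappa : R) :
  0 < kappa -> (0 < #|A|)%N -> ~ coverable M A B kappa ->
  exists Z : {set I}, [/\ Z \subset A, #|Z|%:R <= #|A|%:R / 4 :> R
    & forall j, j \in B ->
        #|[set i in A :\: Z | M i j]|%:R <= kappa * #|A|%:R].
Proof.
move=> k0 A0 ncov.
have s0 : 0 < kappa * #|A|%:R by rewrite mulr_gt0 // ltr0n.
have [tau ct tauB] := greedy_clustering M A B s0.
exists [set i | tau i != None]; split.
- apply/subsetP => i; rewrite inE.
  by case: (tau i) (ct.1 i) => // j /(_ j erefl)[].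
- by rewrite leNgt; apply/negP => lt; apply: ncov; exists tau => //; exact: ltW.
- move=> j jB; apply/ltW; apply: le_lt_trans (tauB j jB).
  rewrite ler_nat subset_leq_card //; apply/subsetP => i.
  by rewrite !inE negbK => /andP[/andP[-> ->] ->].
Qed.

(** [T] is maximal within the budget [q]. If it is not all of [U], one more element overshoots; as
    [2 * k <= q], [T] is then nonempty and [1 + #|T| <= 2 * #|T|]. *)
Lemma subset_of_mass (R : realType) (J : finType) (U : {set J}) (q k : R) :
  0 < k -> 2 * k <= q ->
  exists2 T : {set J}, T \subset U
    & #|T|%:R * (2 * k) <= q /\ (T = U \/ q / 4 <= #|T|%:R * k).
Proof.
move=> k0 kq.
pose P (T : {set J}) := (T \subset U) && (#|T|%:R * (2 * k) <= q).
have P0 : P set0 by rewrite /P sub0set cards0 mul0r /=; lra.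
have [T /maxsetP[/andP[TU Tq] Tmax] _] := maxset_exists P0.
exists T => //; split=> //.
have [->|TneU] := eqVneq T U; first by left.
right; have /set0Pn[j] : U :\: T != set0.
  by apply: contraNneq TneU => UT0; rewrite eqEsubset TU -setD_eq0 UT0 eqxx.
rewrite inE => /andP[jT jU].
have card_jT : #|j |: T|%:R = 1 + #|T|%:R :> R by rewrite cardsU1 jT natrD.
have big : q < (1 + #|T|%:R) * (2 * k).
  rewrite ltNge -card_jT; apply/negP => le_q; move: jT; apply/negP;
    rewrite negbK.
  rewrite -(Tmax (j |: T)) ?setU11 ?subsetUr // /P le_q andbT.
  by rewrite subUset sub1set jU TU.
have [T0|T1] := posnP #|T|; first by rewrite T0 addr0 mul1r in big; lra.
have : 1 <= #|T|%:R :> R by rewrite ler1n.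
by nra.
Qed.

Lemma sum_sqr_le (R : realType) (J : finType) (f : J -> R) :
  (forall j, 0 <= f j) -> \sum_j f j ^+ 2 <= (\sum_j f j) ^+ 2.
Proof.
move=> f0; rewrite expr2 mulr_suml; apply: ler_sum => j _.
rewrite expr2 ler_wpM2l // (bigD1 j) //= lerDl.
by apply: sumr_ge0 => i _.
Qed.

Lemma card_covered (I J : finType) (tau : I -> option J) (T : {set J}) :
  #|[set i | oapp (fun j => j \in T) false (tau i)]| =
  (\sum_(j in T) #|fibre tau j|)%N.
Proof.
rewrite -sum1_card (eq_bigr (fun j => \sum_(i | tau i == Some j) 1)%N);
  last first.
  by move=> j _; rewrite -sum1_card; apply: eq_bigl => i; rewrite inE.
rewrite (exchange_big_dep predT) //= big_mkcond; apply: eq_bigr => i _.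
rewrite inE; case: (tau i) => [j|] /=.
  case: (boolP (j \in T)) => jT.
    rewrite (big_pred1 j) // => k; rewrite (inj_eq Some_inj) eq_sym.
    by rewrite andbC /=; case: eqP => //= ->.
  by rewrite big_pred0 // => k; apply/negP => /andP[kT /eqP[jk]];
    rewrite jk kT in jT.
by rewrite big_pred0 // => k; rewrite andbF.
Qed.

(** * Recentring along clusters *)

(** Recentring the rows of a cluster [t] changes their products with [v b] by the weighted density
    [N t b]. One new coordinate per cluster repairs this at a cost below the gain in the row
    norms. *)
Lemma cluster_step (R : realType) (I J : finType) (M : I -> J -> bool)
    (A : {set I}) (B Z : {set J}) (a c G kappa : R) :
  1 <= G -> a <= G -> c <= G -> (0 < #|A|)%N -> factored M A B a c ->
  0 < kappa -> 2 * kappa <= (32 * G ^+ 2)^-1 -> coverable M A B kappa ->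
  Z \subset B -> #|Z|%:R <= #|B|%:R / 4 :> R ->
  (forall i, i \in A -> #|[set j in B :\: Z | M i j]|%:R <= 2 * kappa *
    #|B|%:R) ->
  exists (A' : {set I}) (B' : {set J}),
    [/\ (128 * G ^+ 2)^-1 * #|A|%:R <= #|A'|%:R,
        #|B|%:R / 2 <= #|B'|%:R :> R,
        factored M A' B' (a - (4 * G)^-1) (c + (16 * G)^-1)
      & edges R M A' B' <= 4 * kappa * (#|A'|%:R * #|B'|%:R)].
Proof.
move=> G1 aG cG A0 [K [u [v [ua vc uvM]]]] k0 kq [tau [tauM taus] tauA] ZB Z4
  degZ.
have G0 : 0 < G by lra.
have Gn0 : G != 0 by rewrite gt_eqF.
(* [q] is the budget for the average column sum of the error; then [(2 * G) ^+ 2 * (4 * q) ^+ 2 =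
   (16 * G ^+ 2)^-1] bounds the growth of the column norms. *)
set q := (32 * G ^+ 2)^-1 in kq.
have q0 : 0 < q by lra.
pose U := [set j | fibre tau j != set0].
have [T TU [Tq Tcase]] := subset_of_mass U k0 kq.
pose A' := [set i | oapp (fun j => j \in T) false (tau i)].
have A'P i : i \in A' -> exists2 t, t \in T & tau i = Some t.
  by rewrite inE; case: (tau i) => //= t tT; exists t.
have SomeF (t k : J) : k != t -> (Some t == Some k) = false.
  by move=> kt; rewrite (inj_eq Some_inj) eq_sym (negPf kt).
have fibreP i t : i \in fibre tau t -> [/\ i \in A, t \in B & M i t].
  by rewrite inE => /eqP /tauM.
have A'A i : i \in A' -> i \in A by move=> /A'P[t _ /tauM[]].
have center t : exists m : I -> R, t \in T ->
  [/\ forall i, 0 <= m i, forall i, i \notin fibre tau t -> m i = 0,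
      \sum_i m i = 1 & forall i, i \in fibre tau t ->
        \sum_k (u i k - \sum_l m l * u l k) ^+ 2 <= a - (2 * G)^-1].
  have [tT|tT] := boolP (t \in T); last by exists (fun _ => 0).
  have t_ne : fibre tau t != set0 by move/subsetP/(_ t tT): TU; rewrite inE.
  have tB : t \in B by case/set0Pn: t_ne => i /fibreP[].
  have [|||m [m1 m2 m3 m4]] := @slice_center R I K (fibre tau t) u (v t) a G G1
    aG t_ne.
  - by move=> i /fibreP[iA _ _]; exact: ua.
  - exact: le_trans (vc _ tB) cG.
  - by move=> i /fibreP[iA _ Mit]; rewrite uvM // Mit.
  - by exists m.
have [mu muP] := boolp.choice center.
pose N t b : R := if t \in T then \sum_i mu t i * (M i b)%:R else 0.
have N0 t b : 0 <= N t b.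
  rewrite /N; case: ifP => // /muP[m0 _ _ _].
  by apply: sumr_ge0 => i _; rewrite mulr_ge0 ?ler0n.
(* For each [t] the sum over [b] is a [mu t]-average of row degrees in [B :\: Z], hence at most
   [2 * kappa * #|B|]. *)
have sumN : \sum_(b in B :\: Z) \sum_t N t b <= q * #|B|%:R.
  rewrite exchange_big /=.
  apply: (@le_trans _ _ (\sum_(t in T) 2 * kappa * #|B|%:R)); last first.
    rewrite sumr_const -[leLHS]mulr_natl mulrA ler_wpM2r ?ler0n //.
  rewrite [leRHS]big_mkcond; apply: ler_sum => t _; rewrite /N.
  case: ifP => [/muP[m0 mf m1 _]|_]; last by rewrite big1.
  rewrite exchange_big /= -[leRHS]mul1r -[X in _ <= X * _]m1 mulr_suml;
    apply: ler_sum => i _.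
  rewrite -mulr_sumr (sum_card R _ (M i));
    have [/fibreP[iA _ _]|/mf->] := boolP (i \in fibre tau t).
    by rewrite ler_wpM2l ?degZ.
  by rewrite !mul0r.
(* By Markov this discards at most [#|B| / 4] columns besides those of [Z]. *)
pose B' := [set b in B :\: Z | \sum_t N t b <= 4 * q].
have B'B b : b \in B' -> b \in B by rewrite !inE => /andP[/andP[]].
have B'Z b : b \in B' -> b \in B :\: Z by rewrite !inE => /andP[].
have cardB' : #|B|%:R / 2 <= #|B'|%:R :> R.
  have := @markov_card R J (B :\: Z) (fun b => \sum_t N t b) (4 * q).
  move=> /(_ (fun j _ => sumr_ge0 _ (fun t _ => N0 t j))) h.
  have {h} := le_trans h sumN; rewrite -/B'.
  have -> : #|B :\: Z|%:R = #|B|%:R - #|Z|%:R :> R.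
    by rewrite cardsD (setIidPr ZB) natrB // subset_leq_card.
  rewrite (mulrC 4 q) -!mulrA ler_pM2l // => h; lra.
exists A', B'; split=> //.
(* Either [T] contains every cluster and [A'] has a quarter of the rows, or [T] has at least
   [q / (4 * kappa)] clusters of at least [kappa * #|A|] rows each. *)
- case: Tcase => [TUeq|Tbig].
    apply: (@le_trans _ _ (#|A|%:R / 4)).
      rewrite mulrC ler_wpM2l ?ler0n // lef_pV2 ?posrE ?mulr_gt0 ?exprn_gt0 //.
      have : 1 <= G ^+ 2 by rewrite exprn_ege1.
      by lra.
    apply: le_trans tauA _; rewrite ler_nat subset_leq_card //.
    apply/subsetP => i; rewrite !inE TUeq; case E : (tau i) => [t|//] _ /=.
    by rewrite inE; apply/set0Pn; exists i; rewrite inE E.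
  rewrite /A' card_covered natr_sum.
  apply: (@le_trans _ _ (\sum_(t in T) kappa * #|A|%:R)).
    rewrite sumr_const -[leRHS]mulr_natl mulrA ler_wpM2r ?ler0n //.
    by apply: le_trans Tbig; rewrite /q le_eqVlt; apply/orP; left; apply/eqP;
      field.
  apply: ler_sum => t tT; apply: taus.
  by move/subsetP/(_ t tT): TU; rewrite inE.
  (* The coordinates in [J] carry the error [N] of the recentring. *)
- pose x i k := oapp (fun t => \sum_l mu t l * u l k) 0 (tau i).
  exists (K + J)%type,
    (fun i k => match k with
      | inl k => u i k - x i k | inr t => (2 * G)^-1 * (tau i == Some t)%:R
        end),
    (fun b k => match k with inl k => v b k | inr t => 2 * G * N t b end).
  split=> [i iA'|b bB'|i b iA' bB'].
  + have [t tT taui] := A'P i iA'; rewrite big_sumType /=.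
    have [_ _ _ m4] := muP t tT.
    have it : i \in fibre tau t by rewrite inE taui.
    have := m4 i it; rewrite /x taui => le1.
    rewrite [X in _ + X](bigD1 t) // eqxx [X in _ + (_ + X)]big1; last first.
      by move=> k /SomeF tk; rewrite tk mulr0 expr0n.
    (* The new coordinate gives back at most half of the gain [(2 * G)^-1]. *)
    have : (2 * G)^-1 ^+ 2 <= (4 * G)^-1.
      rewrite exprVn lef_pV2 ?posrE ?mulr_gt0 ?exprn_gt0 ?mulr_gt0 //.
      by nra.
    have -> : (2 * G)^-1 = 2 * (4 * G)^-1 by field.
    move: le1; have -> : (2 * G)^-1 = 2 * (4 * G)^-1 by field.
    by rewrite mulr1 addr0; lra.
  + rewrite big_sumType /= lerD ?vc ?B'B //.
    under eq_bigr do rewrite exprMn; rewrite -mulr_sumr.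
    have s1 : \sum_t N t b <= 4 * q by move: bB'; rewrite inE => /andP[].
    have s0 : 0 <= \sum_t N t b by apply: sumr_ge0 => t _.
    have s2 : \sum_t N t b ^+ 2 <= (4 * q) ^+ 2.
      apply: le_trans (sum_sqr_le (fun t => N0 t b)) _.
      by rewrite lerXn2r ?nnegrE // mulr_ge0 // ltW.
    apply: (@le_trans _ _ ((2 * G) ^+ 2 * (4 * q) ^+ 2)).
      by rewrite ler_wpM2l ?sqr_ge0.
    have -> : (2 * G) ^+ 2 * (4 * q) ^+ 2 = (16 * G ^+ 2)^-1.
      by rewrite /q; field.
    by rewrite lef_pV2 ?posrE ?mulr_gt0 ?exprn_gt0 //; nra.
  + have [t tT taui] := A'P i iA'; rewrite big_sumType /=.
    have [m0 mf _ _] := muP t tT.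
    have -> : \sum_k (u i k - x i k) * v b k = (M i b)%:R - N t b.
      under eq_bigr do rewrite mulrBl; rewrite sumrB uvM ?A'A ?B'B //.
      congr (_ - _); rewrite /x taui /N tT /=.
      under eq_bigr do rewrite mulr_suml; rewrite exchange_big /=.
      apply: eq_bigr => l _.
      have [/fibreP[lA _ _]|/mf->] := boolP (l \in fibre tau t).
        rewrite -uvM ?B'B // mulr_sumr.
        by apply: eq_bigr => k _; rewrite mulrA.
      by rewrite mul0r big1 // => k _; rewrite !mul0r.
    rewrite taui (bigD1 t) // eqxx [X in _ + (_ + X)]big1; last first.
      by move=> k /SomeF tk; rewrite tk mulr0 mul0r.
    by rewrite addr0 mulr1; field.
- apply: (@le_trans _ _ (\sum_(i in A') 2 * kappa * #|B|%:R)).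
    apply: ler_sum => i iA'; apply: le_trans (degZ i (A'A _ iA')).
    rewrite (sum_card R _ (M i)) ler_nat subset_leq_card //; apply/subsetP => b.
    by rewrite inE => /andP[/B'Z bZ Mib]; rewrite inE bZ Mib.
  rewrite sumr_const -[leLHS]mulr_natl [leRHS]mulrCA ler_wpM2l ?ler0n //.
  by nra.
Qed.

(** * One round: the choice of the scale *)

Lemma factoredS (R : realType) (I J : finType) (M : I -> J -> bool)
    (A A' : {set I}) (B B' : {set J}) (a c : R) :
  A' \subset A -> B' \subset B -> factored M A B a c -> factored M A' B' a c.
Proof.
move=> /subsetP sA /subsetP sB [K [u [v [ua vc uvM]]]].
exists K, u, v; split=> [i /sA|j /sB|i j /sA iA /sB jB]; [exact: ua|exact: vc|].
exact: uvM.
Qed.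

Lemma factored_tr (R : realType) (I J : finType) (M : I -> J -> bool)
    (A : {set I}) (B : {set J}) (a c : R) :
  factored M A B a c -> factored (fun j i => M i j) B A c a.
Proof.
move=> [K [u [v [ua vc uvM]]]]; exists K, v, u; split=> // j i jB iA.
by rewrite -uvM //; apply: eq_bigr => k _; rewrite mulrC.
Qed.

Lemma factored_ge0 (R : realType) (I J : finType) (M : I -> J -> bool)
    (A : {set I}) (B : {set J}) (a c : R) :
  (0 < #|A|)%N -> factored M A B a c -> 0 <= a.
Proof.
move=> /card_gt0P[i iA] [K [u [v [ua _ _]]]]; apply: le_trans (ua i iA).
by apply: sumr_ge0 => k _; exact: sqr_ge0.
Qed.

Lemma edges_tr (R : realType) (I J : finType) (M : I -> J -> bool)
    (A : {set I}) (B : {set J}) :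
  edges R (fun j i => M i j) B A = edges R M A B.
Proof. exact: exchange_big. Qed.

(** A cluster lies in the support of one column, whose density therefore bounds the scale. *)
Lemma coverable_le (R : realType) (I J : finType) (M : I -> J -> bool)
    (A : {set I}) (B : {set J}) (kappa d : R) :
  (0 < #|A|)%N -> coverable M A B kappa ->
  (forall j, j \in B -> \sum_(i in A) (M i j)%:R <= d * #|A|%:R) -> kappa <= d.
Proof.
move=> A0 [tau [tauM taus] tauA] degB.
have A0' : 0 < #|A|%:R :> R by rewrite ltr0n.
have : 0 < #|[set i | tau i != None]|%:R :> R by lra.
rewrite ltr0n => /card_gt0P[i]; rewrite inE; case taui : (tau i) => [j|//] _.
have [iA jB _] := tauM i j taui.
rewrite -(ler_pM2r A0'); apply: le_trans (degB j jB).
have /taus/le_trans -> // : fibre tau j != set0.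
  by apply/set0Pn; exists i; rewrite inE taui.
rewrite (sum_card R A (M^~ j)) ler_nat subset_leq_card //.
by apply/subsetP => l; rewrite !inE => /eqP/tauM[-> _ ->].
Qed.

(** At this scale a single row is already a cluster, so every nonzero row may pick any column of its
    support. *)
Lemma coverable_small (R : realType) (I J : finType) (M : I -> J -> bool)
    (A : {set I}) (B : {set J}) (kappa : R) :
  kappa * #|A|%:R <= 1 ->
  #|A|%:R / 4 <= #|[set i in A | [exists j in B, M i j]]|%:R :> R ->
  coverable M A B kappa.
Proof.
move=> kA cov.
exists (fun i => if i \in A then [pick j in B | M i j] else None).
  split=> [i j|j j0].
    by case: ifP => // iA; case: pickP => // k /andP[kB Mik] [<-].
  by apply: le_trans kA _; rewrite ler1n card_gt0.
apply: le_trans cov _; rewrite ler_nat subset_leq_card //; apply/subsetP => i.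
rewrite !inE => /andP[-> /exists_inP[j jB Mij]].
by case: pickP => // /(_ j); rewrite jB Mij.
Qed.

(** Failure to cover the columns at scale [2 * kappa] supplies the set [Z] and the row degree bound
    of [cluster_step]. *)
Lemma stage_coverable (R : realType) (I J : finType) (M : I -> J -> bool)
    (A : {set I}) (B : {set J}) (a c G p kappa : R) :
  1 <= G -> a <= G -> c <= G -> (0 < #|A|)%N -> (0 < #|B|)%N ->
  factored M A B a c -> 0 < kappa -> kappa <= 8 * p ->
  16 * p <= (32 * G ^+ 2)^-1 ->
  coverable M A B kappa -> ~ coverable (fun j i => M i j) B A (2 * kappa) ->
  exists (A' : {set I}) (B' : {set J}),
    [/\ (128 * G ^+ 2)^-1 * #|A|%:R <= #|A'|%:R,
        (128 * G ^+ 2)^-1 * #|B|%:R <= #|B'|%:R,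
        factored M A' B' (a - (4 * G)^-1) (c + (16 * G)^-1)
      & edges R M A' B' <= 32 * p * (#|A'|%:R * #|B'|%:R)].
Proof.
move=> G1 aG cG A0 B0 fM k0 kp pG cov ncov.
have [|Z [ZB Z4 degZ]] := not_coverable _ B0 ncov; first by lra.
have [|A' [B' [cA cB fM' e']]] := cluster_step G1 aG cG A0 fM k0 _ cov ZB Z4
  degZ.
  by lra.
exists A', B'; split=> //.
  apply: le_trans cB; rewrite mulrC ler_wpM2l ?ler0n //.
  have G2 : 1 <= G ^+ 2 by rewrite exprn_ege1.
  by rewrite lef_pV2 ?posrE; lra.
apply: le_trans e' _; rewrite ler_wpM2r ?mulr_ge0 ?ler0n //.
by lra.
Qed.

Lemma stage (R : realType) (I J : finType) (M : I -> J -> bool)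
    (A : {set I}) (B : {set J}) (a c G p : R) :
  1 <= G -> a <= G -> c <= G -> (0 < #|A|)%N -> (0 < #|B|)%N ->
  factored M A B a c -> 0 < p -> 16 * p <= (32 * G ^+ 2)^-1 ->
  edges R M A B <= p * (#|A|%:R * #|B|%:R) ->
  (exists (A' : {set I}) (B' : {set J}),
    [/\ #|A|%:R / 2 <= #|A'|%:R :> R, #|B|%:R / 2 <= #|B'|%:R :> R
      & forall i j, i \in A' -> j \in B' -> ~~ M i j]) \/
  (exists (A' : {set I}) (B' : {set J}) (a' c' : R),
    [/\ (256 * G ^+ 2)^-1 * #|A|%:R <= #|A'|%:R,
        (256 * G ^+ 2)^-1 * #|B|%:R <= #|B'|%:R,
        factored M A' B' a' c', a' + c' <= a + c - (8 * G)^-1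
      & edges R M A' B' <= 32 * p * (#|A'|%:R * #|B'|%:R)]).
Proof.
move=> G1 aG cG A0 B0 fM p0 pG eM.
have A0' : 0 < #|A|%:R :> R by rewrite ltr0n.
have B0' : 0 < #|B|%:R :> R by rewrite ltr0n.
have G2 : 1 <= G ^+ 2 by rewrite exprn_ege1.
(* Rows, then columns, of more than four times the average density are dropped; three quarters of
   each remain, and relative densities are then at most [8 * p]. *)
pose A1 := [set i in A | \sum_(j in B) (M i j)%:R <= 4 * p * #|B|%:R :> R].
have A1A : A1 \subset A by apply/subsetP => i; rewrite inE => /andP[].
have cA1 : 3 / 4 * #|A|%:R <= #|A1|%:R :> R.
  have := @markov_card R I A (fun i => \sum_(j in B) (M i j)%:R) (4 * p *
    #|B|%:R).
  move=> /(_ (fun i _ => sumr_ge0 _ (fun j _ => ler0n _ _)))/le_trans/(_ eM).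
  rewrite -/A1 (_ : 4 * p * _ * _ = p * #|B|%:R * (4 * (#|A|%:R - #|A1|%:R)));
    last by ring.
  rewrite (_ : p * (_ * _) = p * #|B|%:R * #|A|%:R); last by ring.
  by rewrite ler_pM2l ?mulr_gt0 //; lra.
pose B1 := [set j in B | \sum_(i in A1) (M i j)%:R <= 4 * p * #|A|%:R :> R].
have B1B : B1 \subset B by apply/subsetP => j; rewrite inE => /andP[].
have cB1 : 3 / 4 * #|B|%:R <= #|B1|%:R :> R.
  have := @markov_card R J B (fun j => \sum_(i in A1) (M i j)%:R) (4 * p *
    #|A|%:R).
  move=> /(_ (fun j _ => sumr_ge0 _ (fun i _ => ler0n _ _)))/le_trans.
  have e1 : \sum_(j in B) \sum_(i in A1) (M i j)%:R <= p * (#|A|%:R * #|B|%:R)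
    :> R.
    apply: le_trans eM; rewrite exchange_big /=.
    rewrite /edges [leLHS]big_mkcond [leRHS]big_mkcond; apply: ler_sum => i _.
    have [iA1|_] := boolP (i \in A1); first by rewrite (subsetP A1A).
    by case: ifP => // _; apply: sumr_ge0 => j _; exact: ler0n.
  move=> /(_ _ e1).
  rewrite -/B1 (_ : 4 * p * _ * _ = p * #|A|%:R * (4 * (#|B|%:R - #|B1|%:R)));
    last by ring.
  rewrite mulrA.
  by rewrite ler_pM2l ?mulr_gt0 //; lra.
have A10 : (0 < #|A1|)%N by rewrite -(ltr0n R); lra.
have B10 : (0 < #|B1|)%N by rewrite -(ltr0n R); lra.
have degA1 i : i \in A1 -> \sum_(j in B1) (M i j)%:R <= 8 * p * #|B1|%:R :> R.
  rewrite inE => /andP[_ le1].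
  have le2 : \sum_(j in B1) (M i j)%:R <= \sum_(j in B) (M i j)%:R :> R.
    rewrite [leLHS]big_mkcond [leRHS]big_mkcond; apply: ler_sum => j _.
    have [jB1|_] := boolP (j \in B1); first by rewrite (subsetP B1B).
    by case: ifP => // _; exact: ler0n.
  by apply: le_trans (le_trans le2 le1) _; nra.
have degB1 j : j \in B1 -> \sum_(i in A1) (M i j)%:R <= 8 * p * #|A1|%:R :> R.
  rewrite inE => /andP[_ le1]; apply: le_trans le1 _; nra.
pose A0s := [set i in A1 | ~~ [exists j in B1, M i j]].
have [big|small] := leP (3 / 4 * #|A1|%:R : R) #|A0s|%:R.
  left; exists A0s, B1; split; [lra|lra|] => i j.
  rewrite inE => /andP[_ /exists_inPn h] jB1; exact: h.
right.
have cE : #|A1|%:R / 4 <= #|[set i in A1 | [exists j in B1, M i j]]|%:R :> R.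
  have split (X : {set I}) (P : pred I) :
      (#|X| = #|[set i in X | P i]| + #|[set i in X | ~~ P i]|)%N.
    rewrite -(cardsID [set i | P i] X); congr (_ + _)%N.
      by apply: eq_card => i; rewrite !inE.
    by apply: eq_card => i; rewrite !inE andbC.
  have : #|A1|%:R = #|[set i in A1 | [exists j in B1, M i j]]|%:R + #|A0s|%:R
    :> R.
    by rewrite -natrD /A0s; congr _%:R; exact: split.
  by lra.
have pow0 k : 0 < 2 ^- k :> R by rewrite invr_gt0 exprn_gt0.
(* The least such [k] is the largest dyadic scale at which one side can be covered; at twice that
   scale neither side can. *)
pose P k := `[< coverable M A1 B1 (2 ^- k : R) \/
                coverable (fun j i => M i j) B1 A1 (2 ^- k : R) >].
have exP : exists k, P k.
  exists #|A1|; apply/asboolP; left; apply: coverable_small => //.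
  rewrite mulrC ler_pdivrMr ?exprn_gt0 // mul1r -natrX ler_nat ltnW //.
  exact: ltn_expl.
case: (ex_minnP exP) => k /asboolP Pk kmin.
have kp : 2 ^- k <= 8 * p.
  case: Pk => /coverable_le; first by apply.
  by apply.
(* Scale 1 is impossible, since [8 * p < 1]. *)
case: k => [|k] in Pk kmin kp.
  have : (32 * G ^+ 2)^-1 <= 1 by rewrite invf_le1 ?mulr_gt0 ?exprn_gt0; lra.
  by move: kp; rewrite expr0 invr1; lra.
have nP : ~ P k by move/kmin; rewrite ltnn.
have two_k : 2 * 2 ^- k.+1 = 2 ^- k :> R.
  by rewrite exprS invfM mulrA divff ?mul1r // pnatr_eq0.
have fM1 := factoredS A1A B1B fM.
have theta (x y z : R) : 3 / 4 * x <= y -> 0 < x ->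
  (128 * G ^+ 2)^-1 * y <= z ->
    (256 * G ^+ 2)^-1 * x <= z.
  move=> xy x0; apply: le_trans.
  rewrite (_ : (256 * G ^+ 2)^-1 = (128 * G ^+ 2)^-1 / 2); last by field; lra.
  by rewrite -mulrA ler_wpM2l ?invr_ge0 ?mulr_ge0 ?exprn_ge0 //; lra.
(* Net decrease of the sum of the two bounds in one round. *)
have gain : (4 * G)^-1 - (16 * G)^-1 >= (8 * G)^-1.
  have h0 : 0 < (16 * G)^-1 by rewrite invr_gt0; lra.
  rewrite (_ : (4 * G)^-1 = 4 * (16 * G)^-1); last by field; lra.
  by rewrite (_ : (8 * G)^-1 = 2 * (16 * G)^-1); [lra | field; lra].
case: Pk => cov.
  have ncov : ~ coverable (fun j i => M i j) B1 A1 (2 * 2 ^- k.+1 : R).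
    by rewrite two_k => cov'; apply: nP; apply/asboolP; right.
  have [A' [B' [cA' cB' fM' eM']]] :=
    stage_coverable G1 aG cG A10 B10 fM1 (pow0 _) kp pG cov ncov.
  exists A', B', (a - (4 * G)^-1), (c + (16 * G)^-1); split=> //.
  - exact: theta cA1 A0' cA'.
  - exact: theta cB1 B0' cB'.
  - by lra.
have ncov : ~ coverable (fun i j => M i j) A1 B1 (2 * 2 ^- k.+1 : R).
  by rewrite two_k => cov'; apply: nP; apply/asboolP; left.
have [B' [A' [cB' cA' fM' eM']]] :=
  stage_coverable G1 cG aG B10 A10 (factored_tr fM1) (pow0 _) kp pG cov ncov.
exists A', B', (a + (16 * G)^-1), (c - (4 * G)^-1); split=> //.
- exact: theta cA1 A0' cA'.
- exact: theta cB1 B0' cB'.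
- exact: factored_tr fM'.
- by lra.
- by rewrite -edges_tr (mulrC #|A'|%:R).
Qed.

(** * Iteration and exponents *)

(** [n] counts the rounds left: each one without a zero rectangle lowers [a + c] by [(8 * G)^-1] and
    multiplies the density bound by 32. At [n = 0] the bound [a + c < 0] contradicts
    nonnegativity. *)
Lemma zero_rectangle_of_sparse (R : realType) (I J : finType) (M : I -> J ->
  bool)
    (G : R) (n : nat) :
  1 <= G ->
  forall (A : {set I}) (B : {set J}) (a c p : R),
    a + c < n%:R / (8 * G) -> a + c <= G -> (0 < #|A|)%N -> (0 < #|B|)%N ->
    factored M A B a c -> 0 < p -> 16 * 32 ^+ n * p <= (32 * G ^+ 2)^-1 ->
    edges R M A B <= p * (#|A|%:R * #|B|%:R) ->
    exists (A' : {set I}) (B' : {set J}),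
      [/\ (256 * G ^+ 2) ^- n / 2 * #|A|%:R <= #|A'|%:R,
          (256 * G ^+ 2) ^- n / 2 * #|B|%:R <= #|B'|%:R
        & forall i j, i \in A' -> j \in B' -> ~~ M i j].
Proof.
move=> G1; have G2 : 1 <= G ^+ 2 by rewrite exprn_ege1.
have G0 : 0 < G by lra.
elim: n => [|n IH] A B a c p acn acG A0 B0 fM p0 pG eM.
  have a0 := factored_ge0 A0 fM; have c0 := factored_ge0 B0 (factored_tr fM).
  by rewrite mul0r in acn; lra.
have a0 := factored_ge0 A0 fM; have c0 := factored_ge0 B0 (factored_tr fM).
have t0 m : 0 < (256 * G ^+ 2) ^- m by rewrite invr_gt0 exprn_gt0 //; lra.
have tn : (256 * G ^+ 2) ^- n.+1 <= 1.
  by rewrite invf_le1 ?exprn_gt0 ?exprn_ege1 //; lra.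
have pn : 16 * p <= (32 * G ^+ 2)^-1.
  apply: le_trans pG; have : 1 <= 32 ^+ n.+1 :> R by rewrite exprn_ege1 //
    ler1n.
  by nra.
have [||[A' [B' [cA cB z]]]|[A' [B' [a' [c' [cA cB fM' ac' e']]]]]] :=
    stage G1 _ _ A0 B0 fM p0 pn eM; [lra|lra| |].
  exists A', B'; split=> //.
    by apply: le_trans cA; rewrite mulrC ler_wpM2l ?ler0n //; lra.
  by apply: le_trans cB; rewrite mulrC ler_wpM2l ?ler0n //; lra.
have tpos : 0 < (256 * G ^+ 2)^-1 by rewrite invr_gt0; lra.
have A'0 : (0 < #|A'|)%N.
  by rewrite -(ltr0n R); apply: lt_le_trans cA; rewrite mulr_gt0 // ltr0n.
have B'0 : (0 < #|B'|)%N.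
  by rewrite -(ltr0n R); apply: lt_le_trans cB; rewrite mulr_gt0 // ltr0n.
have [||||A2 [B2 [cA2 cB2 z]]] := IH A' B' a' c' (32 * p) _ _ A'0 B'0 fM' _ _
  e'.
- by move: acn; rewrite -natr1 mulrDl mul1r; lra.
- have : 0 < (8 * G)^-1 by rewrite invr_gt0; lra.
  by lra.
- by lra.
- by move: pG; rewrite exprSr !mulrA.
have step (x y z' : R) : (256 * G ^+ 2)^-1 * x <= y ->
    (256 * G ^+ 2) ^- n / 2 * y <= z' -> (256 * G ^+ 2) ^- n.+1 / 2 * x <= z'.
  move=> xy; apply: le_trans.
  have -> : (256 * G ^+ 2) ^- n.+1 / 2 * x =
      (256 * G ^+ 2) ^- n / 2 * ((256 * G ^+ 2)^-1 * x).
    by rewrite exprSr invfM; ring.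
  by have tn0 := t0 n; rewrite ler_wpM2l //; lra.
exists A2, B2; split=> //; [exact: step cA cA2 | exact: step cB cB2].
Qed.

Lemma bernoulli (R : realType) (d : R) (n : nat) :
  0 <= d -> 1 + n%:R * d <= (1 + d) ^+ n.
Proof.
move=> d0; elim: n => [|n IH]; first by rewrite mul0r addr0 expr0.
rewrite exprS; apply: (@le_trans _ _ ((1 + d) * (1 + n%:R * d))).
  have nd : 0 <= n%:R * d ^+ 2 by rewrite mulr_ge0 ?ler0n ?sqr_ge0.
  by rewrite -natr1; lra.
by rewrite ler_wpM2l //; lra.
Qed.

(** The first summand pays a factor 4 for each amplification round and one for the initial density;
    the second pays [2 ^ (12 * g)] for each of [33 * g ^ 2] clustering rounds and a final factor
    2. *)
Definition rectangle_exponent (g : nat) : nat :=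
  (2 * (98 * g * (178 * g ^ 2).+1).+1 + (12 * g * (33 * g ^ 2)).+1)%N.

Lemma sqr_le_exp2 (g : nat) : (g ^ 2 <= 2 ^ (2 * g))%N.
Proof. by rewrite mulnC expnM leq_sqr ltnW // ltn_expl. Qed.

Lemma zero_rectangle (R : realType) (I J : finType) (M : I -> J -> bool)
    (g : nat) :
  (0 < g)%N -> (0 < #|I|)%N -> (0 < #|J|)%N ->
  factored M [set: I] [set: J] (g%:R : R) g%:R ->
  edges R M [set: I] [set: J] <= #|I|%:R * #|J|%:R / 2 ->
  exists (A : {set I}) (B : {set J}),
    [/\ 2 ^- rectangle_exponent g * #|I|%:R <= #|A|%:R :> R,
        2 ^- rectangle_exponent g * #|J|%:R <= #|B|%:R :> R
      & forall i j, i \in A -> j \in B -> ~~ M i j].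
Proof.
move=> g0 I0 J0 fM eM.
have g1 : 1 <= g%:R :> R by rewrite ler1n.
have g0' : 0 < g%:R :> R by lra.
have I0' : 0 < #|I|%:R :> R by rewrite ltr0n.
have J0' : 0 < #|J|%:R :> R by rewrite ltr0n.
(* The target density is [2 ^- N]. By Bernoulli [98 * g] rounds double [L - 1], which starts at 1/2,
   hence [N.+1] doublings. With [G = 2 * g], [n] rounds suffice because [2 * g < 33 / 16 * g]; and
   [178 = 4 + 5 * 33 + 7 + 2] absorbs [16 * 32 ^ n * 32 * G ^ 2]. *)
pose N := (178 * g ^ 2)%N; pose k := (98 * g * N.+1)%N;
  pose n := (33 * g ^ 2)%N.
have p2 m : 0 < 2 ^- m :> R by rewrite invr_gt0 exprn_gt0.
have [A [B]] := amplify [set: I] [set: J] k g0' (ltW (p2 1%N)) fM.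
rewrite !cardsT expr1; set L := 1 + 2^-1 * _ => amp.
have e0 (X : {set I}) (Y : {set J}) : 0 <= edges R M X Y.
  by apply: sumr_ge0 => i _; apply: sumr_ge0 => j _; exact: ler0n.
have Lbig : 2 ^+ N <= L.
  have d0 : 0 < (98 * g%:R)^-1 :> R by rewrite invr_gt0 mulr_gt0.
  have two : 2 <= (1 + (98 * g%:R)^-1) ^+ (98 * g) :> R.
    apply: le_trans (bernoulli (98 * g) (ltW d0)).
    by rewrite natrM divff // gt_eqF // mulr_gt0.
  have : 2 ^+ N.+1 <= (1 + (98 * g%:R)^-1) ^+ k :> R.
    by rewrite /k exprM lerXn2r // nnegrE; lra.
  by rewrite exprS /L; lra.
have amp' : #|I|%:R * #|J|%:R * 2 ^- (2 * k.+1) <= #|A|%:R * #|B|%:R - L *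
  edges R M A B.
  apply: le_trans amp.
  rewrite mulnS exprD exprM (_ : 2 ^+ 2 = 4); last by ring.
  rewrite invfM mulrA ler_pM2r ?invr_gt0 ?exprn_gt0 //.
  by move: eM; lra.
have IJ0 : 0 < #|I|%:R * #|J|%:R * 2 ^- (2 * k.+1) :> R by rewrite !mulr_gt0.
have L0 : 0 < L by apply: lt_le_trans Lbig; rewrite exprn_gt0.
have LE0 : 0 <= L * edges R M A B by rewrite mulr_ge0 // ltW.
have AB : #|I|%:R * #|J|%:R * 2 ^- (2 * k.+1) <= #|A|%:R * #|B|%:R :> R by lra.
have AB0 : 0 < #|A|%:R * #|B|%:R :> R by lra.
have [A0 B0] : (0 < #|A|)%N /\ (0 < #|B|)%N.
  by apply/andP; rewrite -muln_gt0 -(ltr0n R) natrM.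
(* A lower bound on the area bounds each side, the other being at most full. *)
have cA : 2 ^- (2 * k.+1) * #|I|%:R <= #|A|%:R :> R.
  rewrite -(ler_pM2r J0'); apply: (@le_trans _ _ (#|A|%:R * #|B|%:R)).
    by apply: le_trans AB; rewrite [leRHS]mulrC mulrA.
  by rewrite ler_wpM2l ?ler0n // ler_nat max_card.
have cB : 2 ^- (2 * k.+1) * #|J|%:R <= #|B|%:R :> R.
  rewrite -(ler_pM2l I0'); apply: (@le_trans _ _ (#|A|%:R * #|B|%:R)).
    by apply: le_trans AB; rewrite -[leRHS]mulrA (mulrC #|J|%:R).
  by rewrite ler_wpM2r ?ler0n // ler_nat max_card.
have eAB : edges R M A B <= 2 ^- N * (#|A|%:R * #|B|%:R).
  rewrite mulrC ler_pdivlMr ?exprn_gt0 //.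
  apply: (@le_trans _ _ (L * edges R M A B)); last by lra.
  by rewrite mulrC ler_wpM2r.
have sq : g%:R ^+ 2 <= 2 ^+ (2 * g) :> R.
  by rewrite -!natrX ler_nat sqr_le_exp2.
have gg : (g <= g ^ 2)%N by rewrite -{1}(expn1 g) leq_pexp2l.
have g21 : (1 <= g ^ 2)%N by rewrite expn_gt0 g0.
have [||||A' [B' [cA' cB' z]]] := @zero_rectangle_of_sparse R I J M (2 * g%:R)
  n _
    A B g%:R g%:R (2 ^- N) _ _ A0 B0 (factoredS (subsetT _) (subsetT _) fM) (p2
      _) _ eAB.
- by lra.
- rewrite /n natrM natrX (_ : 33%:R * g%:R ^+ 2 / (8 * (2 * g%:R)) = 33 / 16 *
  g%:R).
    by lra.
  by field; rewrite gt_eqF.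
- by lra.
- have -> : 32 * (2 * g%:R) ^+ 2 = 2 ^+ 7 * g%:R ^+ 2 :> R by ring.
  rewrite ler_pdivrMr ?exprn_gt0 // [leRHS]mulrC ler_pdivlMr ?mulr_gt0
    ?exprn_gt0 //.
  apply: (@le_trans _ _ (2 ^+ 4 * 2 ^+ (5 * n) * (2 ^+ 7 * 2 ^+ (2 * g)))).
    rewrite (_ : 16 = 2 ^+ 4); last by ring.
    rewrite (exprM _ 5) (_ : 2 ^+ 5 = 32); last by ring.
    by rewrite ler_wpM2l ?mulr_ge0 ?exprn_ge0 // ler_wpM2l ?exprn_ge0.
  rewrite -!exprD ler_weXn2l ?ler1n //.
  rewrite /N /n.
  have -> : (178 * g ^ 2 = 4 * g ^ 2 + 5 * (33 * g ^ 2) + (7 * g ^ 2 + 2 * g ^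
    2))%N.
    by rewrite mulnA -!mulnDl.
  have c_le (c : nat) : (c <= c * g ^ 2)%N by rewrite leq_pmulr.
  apply: leq_add; first exact: leq_add.
  by apply: leq_add => //; rewrite leq_mul.
have theta : 2 ^- (12 * g * n) <= (256 * (2 * g%:R) ^+ 2) ^- n :> R.
  rewrite lef_pV2 ?posrE ?exprn_gt0 ?mulr_gt0 ?exprn_gt0 ?mulr_gt0 //.
  rewrite exprM lerXn2r ?nnegrE ?exprn_ge0 ?mulr_ge0 ?exprn_ge0 ?mulr_ge0
    ?ler0n //.
  have -> : 256 * (2 * g%:R) ^+ 2 = 2 ^+ 10 * g%:R ^+ 2 :> R by ring.
  rewrite (_ : 12 * g = 10 * g + 2 * g)%N; last by rewrite -mulnDl.
  rewrite exprD ler_pM ?exprn_ge0 // ler_weXn2l ?ler1n //.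
  by rewrite leq_pmulr.
have final (x y z' : R) : 0 <= x -> 2 ^- (2 * k.+1) * x <= y ->
    (256 * (2 * g%:R) ^+ 2) ^- n / 2 * y <= z' ->
    2 ^- rectangle_exponent g * x <= z'.
  move=> x0 xy; apply: le_trans.
  have -> : 2 ^- rectangle_exponent g * x =
      2 ^- (12 * g * n) / 2 * (2 ^- (2 * k.+1) * x).
    rewrite /rectangle_exponent -/N -/k -/n exprD exprS !invfM.
    by ring.
  have := p2 (12 * g * n)%N; have := p2 (2 * k.+1)%N => p1 p3.
  apply: ler_pM; [lra | by rewrite mulr_ge0 // ltW | lra | exact: xy].
exists A', B'; split=> //; [exact: final cA cA' | exact: final cB cB'].
Qed.

(** * Complementation and the passage from [gamma2] *)

(** The all-ones matrix costs a single coordinate, equal to 1 on both sides. *)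
Lemma factored_compl (R : realType) (I J : finType) (M : I -> J -> bool)
    (A : {set I}) (B : {set J}) (a c : R) :
  factored M A B a c -> factored (fun i j => ~~ M i j) A B (a + 1) (c + 1).
Proof.
move=> [K [u [v [ua vc uvM]]]].
exists (K + unit)%type, (fun i k => if k is inl k' then - u i k' else 1),
  (fun j k => if k is inl k' then v j k' else 1).
have sum1 (x : R) : \sum_(k : unit) x = x by rewrite sumr_const card_unit.
split=> [i iA|j jB|i j iA jB]; rewrite big_sumType /= sum1 ?expr1n ?mulr1.
- by under eq_bigr do rewrite sqrrN; rewrite lerD2r ua.
- by rewrite lerD2r vc.
- under eq_bigr do rewrite mulNr; rewrite sumrN uvM //.
  by case: (M i j); rewrite /= ?addNr // oppr0 add0r.
Qed.

Lemma factoredW (R : realType) (I J : finType) (M : I -> J -> bool)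
    (A : {set I}) (B : {set J}) (a a' c c' : R) :
  a <= a' -> c <= c' -> factored M A B a c -> factored M A B a' c'.
Proof.
move=> aa' cc' [K [u [v [ua vc uvM]]]]; exists K, u, v.
split=> // [i iA|j jB]; first exact: le_trans (ua i iA) aa'.
exact: le_trans (vc j jB) cc'.
Qed.

(** Cauchy-Schwarz, from the square of [u - z * v] at [z = P]; the value [z = (Q + 1)^-1] excludes
    [P = 0]. *)
Lemma sqr_dot_ge1 (R : realType) (K : finType) (u v : K -> R) :
  \sum_k u k * v k = 1 -> 1 <= (\sum_k u k ^+ 2) * (\sum_k v k ^+ 2).
Proof.
move=> uv1; set P := \sum_k _; set Q := \sum_k _.
have sq z : 0 <= P - 2 * z + z ^+ 2 * Q.
  have <- : \sum_k (u k - z * v k) ^+ 2 = P - 2 * z + z ^+ 2 * Q.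
    transitivity (P - 2 * z * (\sum_k u k * v k) + z ^+ 2 * Q).
      rewrite /P /Q !mulr_sumr -sumrN -!big_split /=.
      by apply: eq_bigr => k _; ring.
    by rewrite uv1 mulr1.
  by apply: sumr_ge0 => k _; exact: sqr_ge0.
have P0 : 0 <= P by apply: sumr_ge0 => k _; exact: sqr_ge0.
have Q0 : 0 <= Q by apply: sumr_ge0 => k _; exact: sqr_ge0.
have [P_eq0|P_neq0] := eqVneq P 0.
  have := sq (Q + 1)^-1; rewrite P_eq0.
  have z0 : 0 < (Q + 1)^-1 by rewrite invr_gt0; lra.
  have zQ : (Q + 1)^-1 * (Q + 1) = 1 by rewrite mulVf // gt_eqF; lra.
  by nra.
have P_gt0 : 0 < P by rewrite lt_def P_neq0.
have := sq P; rewrite (_ : P - 2 * P + P ^+ 2 * Q = P * (P * Q - 1));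
  last by ring.
by rewrite pmulr_rge0 // subr_ge0.
Qed.

Lemma row_norm_ge (R : realType) (m k : nat) (U : 'M[R]_(m, k)) (i : 'I_m) :
  \sum_j U i j ^+ 2 <= row_norm U ^+ 2.
Proof.
have le1 : l2norm (row i U) <= row_norm U by exact: le_bigmax.
have s0 : 0 <= \sum_j U i j ^+ 2 by apply: sumr_ge0 => j _; exact: sqr_ge0.
have l0 : 0 <= l2norm (row i U) by exact: sqrtr_ge0.
apply: (@le_trans _ _ (l2norm (row i U) ^+ 2)).
  rewrite /l2norm sqr_sqrtr; first by under [leRHS]eq_bigr do rewrite mxE.
  by apply: sumr_ge0 => j _; exact: sqr_ge0.
by rewrite lerXn2r // nnegrE //; apply: le_trans le1.
Qed.

Lemma col_norm_ge (R : realType) (k n : nat) (V : 'M[R]_(k, n)) (j : 'I_n) :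
  \sum_i V i j ^+ 2 <= col_norm V ^+ 2.
Proof.
have := row_norm_ge V^T j.
have -> : row_norm V^T = col_norm V.
  by rewrite /row_norm /col_norm; apply: eq_bigr => i _; rewrite -tr_col.
by under eq_bigr do rewrite mxE.
Qed.

Lemma gamma2_value_ge1 (R : realType) (m n : nat) (M : 'M[R]_(m, n))
    (x : R) (i : 'I_m) (j : 'I_n) :
  M i j = 1 -> gamma2_values M x -> 1 <= x.
Proof.
move=> Mij Mx; have x0 := gamma2_values_ge0 Mx.
case: Mx => k [U [V [MUV xE]]].
have le1 : 1 <= (\sum_l U i l ^+ 2) * (\sum_l V l j ^+ 2).
  by apply: sqr_dot_ge1; rewrite -Mij MUV mxE.
have : 1 <= x ^+ 2.
  rewrite xE exprMn; apply: le_trans le1 _; apply: ler_pM.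
  - by apply: sumr_ge0 => l _; exact: sqr_ge0.
  - by apply: sumr_ge0 => l _; exact: sqr_ge0.
  - exact: row_norm_ge.
  - exact: col_norm_ge.
by nra.
Qed.

Lemma gamma2_value_factored (R : realType) (m n : nat) (M : 'M[R]_(m, n))
    (x : R) (i0 : 'I_m) (j0 : 'I_n) :
  boolean_mx M -> M i0 j0 = 1 -> gamma2_values M x ->
  factored (fun i j => M i j == 1) [set: 'I_m] [set: 'I_n] x x.
Proof.
move=> boolM M1 Mx; have x1 := gamma2_value_ge1 M1 Mx.
case: Mx => k [U [V [MUV xE]]].
have r0 : 0 <= row_norm U.
  by rewrite /row_norm; elim/big_rec: _ => // i y _ y0; rewrite le_max y0 orbT.
have c0 : 0 <= col_norm V.
  by rewrite /col_norm; elim/big_rec: _ => // i y _ y0; rewrite le_max y0 orbT.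
have rp : 0 < row_norm U by rewrite lt_def r0 andbT; apply/eqP => r;
  rewrite xE r in x1; lra.
have cp : 0 < col_norm V by rewrite lt_def c0 andbT; apply/eqP => r;
  rewrite xE r in x1; lra.
(* This rescaling balances the two factors: both squared norms become at most the product [x]. *)
pose t := Num.sqrt (col_norm V / row_norm U).
have t2 : t ^+ 2 = col_norm V / row_norm U by rewrite sqr_sqrtr // divr_ge0.
have t0 : 0 < t by rewrite sqrtr_gt0 divr_gt0.
exists 'I_k, (fun i l => t * U i l), (fun j l => t^-1 * V l j).
split=> [i _|j _|i j _ _].
- under eq_bigr do rewrite exprMn; rewrite -mulr_sumr t2.
  apply: (@le_trans _ _ (col_norm V / row_norm U * row_norm U ^+ 2)).
    by rewrite ler_wpM2l ?divr_ge0 // row_norm_ge.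
  by rewrite xE le_eqVlt; apply/orP; left; apply/eqP; field; rewrite gt_eqF.
- under eq_bigr do rewrite exprMn; rewrite -mulr_sumr exprVn t2.
  apply: (@le_trans _ _ ((col_norm V / row_norm U)^-1 * col_norm V ^+ 2)).
    by rewrite ler_wpM2l ?invr_ge0 ?divr_ge0 // col_norm_ge.
  by rewrite xE le_eqVlt; apply/orP; left; apply/eqP; field; rewrite !gt_eqF.
- transitivity (M i j).
    rewrite MUV mxE; apply: eq_bigr => l _; field; exact: lt0r_neq0.
  by case: (boolM i j) => ->; rewrite ?eqxx // eq_sym oner_eq0.
Qed.

Lemma submatrix_const (R : realType) (m n : nat) (M : 'M[R]_(m, n))
    (A : {set 'I_m}) (B : {set 'I_n}) (x : R) :
  (forall i j, i \in A -> j \in B -> M i j = x) ->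
  submatrix A B M = const_mx x.
Proof. by move=> Mx; apply/matrixP => i j; rewrite !mxE Mx // enum_valP. Qed.

(** Either [M] or its complement has at most half ones; the complement raises the bounds by 1,
    whence [x + 1 <= g%:R]. *)
Lemma constant_rectangle (R : realType) (I J : finType) (M : I -> J -> bool)
    (g : nat) (x : R) :
  (0 < g)%N -> (0 < #|I|)%N -> (0 < #|J|)%N -> x + 1 <= g%:R ->
  factored M [set: I] [set: J] x x ->
  exists (b : bool) (A : {set I}) (B : {set J}),
    [/\ 2 ^- rectangle_exponent g * #|I|%:R <= #|A|%:R :> R,
        2 ^- rectangle_exponent g * #|J|%:R <= #|B|%:R :> R
      & forall i j, i \in A -> j \in B -> M i j = b].
Proof.
move=> g0 I0 J0 xg fM.
have xg' : x <= g%:R by lra.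
have sumE : edges R M setT setT + edges R (fun i j => ~~ M i j) setT setT =
    #|I|%:R * #|J|%:R.
  rewrite /edges -big_split /= -[#|I|]sum1_card natr_sum mulr_suml.
  rewrite (eq_bigl xpredT); last by move=> i; rewrite inE.
  apply: eq_bigr => i _; rewrite -big_split /= mul1r -sum1_card natr_sum.
  rewrite (eq_bigl xpredT); last by move=> j; rewrite inE.
  by apply: eq_bigr => j _; case: (M i j); rewrite /= ?addr0 ?add0r.
have [half|half] := leP (edges R M setT setT) (#|I|%:R * #|J|%:R / 2).
  have [A [B [cA cB z]]] := zero_rectangle g0 I0 J0 (factoredW xg' xg' fM) half.
  by exists false, A, B; split=> // i j iA jB; apply: negbTE; exact: z.
have half' : edges R (fun i j => ~~ M i j) setT setT <= #|I|%:R * #|J|%:R / 2.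
  by lra.
have fM' := factoredW xg xg (factored_compl fM).
have [A [B [cA cB z]]] := zero_rectangle g0 I0 J0 fM' half'.
by exists true, A, B; split=> // i j iA jB; apply/negPn; exact: z.
Qed.

(** The exponent is [35284 * g ^ 3 + 196 * g + 3]. *)
Lemma rectangle_exponent_le (R : realType) (g : nat) :
  (0 < g)%N -> (rectangle_exponent g)%:R <= 200 ^+ 2 * g%:R ^+ 3 :> R.
Proof.
move=> g0; have g1 : 1 <= g%:R :> R by rewrite ler1n.
rewrite /rectangle_exponent -!natr1 !(natrD, natrM, natrX) -?natr1.
rewrite !(natrD, natrM, natrX) -?natr1 !(natrD, natrM, natrX).
have : 1 <= g%:R ^+ 3 :> R by rewrite exprn_ege1.
have : g%:R <= g%:R ^+ 3 :> R by rewrite ler_eXnr.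
lra.
Qed.

Theorem theorem1p1 (R : realType) :
  exists C : R, 0 < C /\
    forall (gamma : R) (m n : nat) (M : 'M[R]_(m, n)),
      0 < gamma -> boolean_mx M -> gamma2 M <= gamma ->
      exists (A : {set 'I_m}) (B : {set 'I_n}) (delta1 delta2 : R),
        [/\ #|A|%:R = delta1 * m%:R,
            #|B|%:R = delta2 * n%:R,
            2 `^ (- (C * gamma ^+ 3)) <= delta1,
            2 `^ (- (C * gamma ^+ 3)) <= delta2
          & submatrix A B M = const_mx 0 \/ submatrix A B M = const_mx 1].
Proof.
(* [200 ^+ 2] comes from the exponent, [4 ^+ 3] from [g <= 4 * gamma]. *)
exists (200 ^+ 2 * 4 ^+ 3); split=> [|gamma m n M gamma0 boolM le_gamma].
  by rewrite mulr_gt0 ?exprn_gt0.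
set C := 200 ^+ 2 * 4 ^+ 3.
have C0 : 0 < C by rewrite mulr_gt0 ?exprn_gt0.
have pow_le1 : 2 `^ (- (C * gamma ^+ 3)) <= 1.
  rewrite -[leRHS](powRr0 2) ler_powR ?ler1n // oppr_le0.
  by rewrite mulr_ge0 ?exprn_ge0 ?ltW.
(* Without a one the whole matrix is the rectangle, even when [m] or [n] is 0; a one forces
   [1 <= gamma]. *)
have [[i0 [j0 M1]]|noone] := pselect (exists i j, M i j = 1); last first.
  exists setT, setT, 1, 1; split; rewrite ?mul1r ?cardsT ?card_ord //; left.
  apply: submatrix_const => i j _ _; case: (boolM i j) => // Mij.
  by case: noone; exists i, j.
have has_infM : has_inf (gamma2_values M).
  by split; [exact: gamma2_values_neq0 | exists 0; exact: gamma2_values_ge0].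
have gamma1 : 1 <= gamma.
  apply: le_trans le_gamma; apply: lb_le_inf; first by case: has_infM.
  by move=> x; exact: gamma2_value_ge1 M1.
(* Attainment of the infimum is avoided: some factorization has [x < gamma + 1], and [gamma + 2 < g]
   leaves room for the complement. *)
have [x Mx x_lt] := inf_adherent ltr01 has_infM.
pose g := Num.truncn (gamma + 3).
have gamma3 : 0 <= gamma + 3 by lra.
have /andP[g_le g_gt] := truncn_itv gamma3.
rewrite -/g in g_le g_gt; rewrite -natr1 in g_gt.
have xg : x + 1 <= g%:R by rewrite /gamma2 in le_gamma; lra.
have g0 : (0 < g)%N by rewrite -(ltr0n R); lra.
have m0 : (0 < m)%N by case: i0 {M1} => i /(leq_ltn_trans (leq0n _)).
have n0 : (0 < n)%N by case: j0 {M1} => j /(leq_ltn_trans (leq0n _)).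
have [||b [A [B [cA cB const]]]] := constant_rectangle g0 _ _ xg
  (gamma2_value_factored boolM M1 Mx); rewrite ?card_ord //.
rewrite !card_ord in cA cB.
have m0' : 0 < m%:R :> R by rewrite ltr0n.
have n0' : 0 < n%:R :> R by rewrite ltr0n.
have pow_le : 2 `^ (- (C * gamma ^+ 3)) <= 2 ^- rectangle_exponent g.
  have -> : 2 ^- rectangle_exponent g = 2 `^ (- (rectangle_exponent g)%:R) :> R.
    by rewrite powRN powR_mulrn.
  rewrite ler_powR ?ler1n // lerN2.
  apply: le_trans (rectangle_exponent_le R g0) _.
  rewrite /C -mulrA -exprMn; apply: ler_wpM2l; first exact: sqr_ge0.
  have g_le4 : g%:R <= 4 * gamma by move: gamma1 g_le; clear; lra.
  by rewrite lerXn2r // nnegrE ?mulr_ge0 // ltW.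
exists A, B, (#|A|%:R / m%:R), (#|B|%:R / n%:R); split.
- by rewrite divfK // gt_eqF.
- by rewrite divfK // gt_eqF.
- by apply: le_trans pow_le _; rewrite ler_pdivlMr.
- by apply: le_trans pow_le _; rewrite ler_pdivlMr.
case: b const => const; [right|left]; apply: submatrix_const => i j iA jB.
  exact/eqP/const.
have := const i j iA jB; case: (boolM i j) => // ->; by rewrite eqxx.
Qed.
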